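(* Let $\mathbb F$ be a field of characteristic $p>0$, let $X$ be a $2\times 3$ matrix of indeterminates over $\mathbb F$, let $I$ be the ideal of $\mathbb F[X]$ generated by the size $2$ minors of $X$, and let $R=\mathbb F[X]/I$. Let $\mathfrak m$ be the homogeneous maximal ideal of $R$, let $\widehat R$ be the $\mathfrak m$-adic completion of $R$, and let $E$ be the injective hull of $R/\mathfrak m$. Then the ring of Frobenius operators $\mathcal F(E)$ is not finitely generated over $\mathcal F^0(E)=\widehat R$.
   Context: For a ring $R$ of prime characteristic $p$ and an $R$-module $M$, $\mathcal F^e(M)$ is the set of additive maps $\varphi\colon M\to M$ with $\varphi(rm)=r^{p^e}\varphi(m)$ for all $r\in R$, $m\in M$. Under addition and composition, $\mathcal F(M)=\bigoplus_{e\ge0}\mathcal F^e(M)$ is an $\mathbb N$-graded (typically noncommutative) ring, the ring of Frobenius operators on $M$, with degree-zero subring $\mathcal F^0(M)=\operatorname{End}_R(M)$. The ring $\mathcal F(M)$ is finitely generated over $\mathcal F^0(M)$ if there is a finite subset of $\mathcal F(M)$ which, together with $\mathcal F^0(M)$, generates $\mathcal F(M)$ as a ring. The module $E$ is also the injective hull of the residue field of the complete local ring $\widehat R$, and $\operatorname{End}_R(E)=\widehat R$. *)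

(* Defs.v *)
From HB Require Import structures.
From mathcomp Require Import all_boot all_order all_algebra.
From mathcomp Require Import generic_quotient ring_quotient.
From mathcomp Require Import boolp mpoly.

Set Implicit Arguments.
Unset Strict Implicit.
Unset Printing Implicit Defensive.

Import GRing.Theory.
Local Open Scope ring_scope.
Local Open Scope quotient_scope.

Section Ideals.
Variable R : comNzRingType.

(* Ideals of the library are boolean predicates; `[< _ >] is classical. *)
Definition genideal (A : R -> Prop) : {pred R} := fun x =>
  `[< exists s : seq (R * R),
        (forall u, u \in s -> A u.2) /\ x = \sum_(u <- s) u.1 * u.2 >].

Definition powideal (I : {pred R}) (n : nat) : {pred R} :=
  genideal (fun x => exists a : 'I_n -> R,
    (forall j, a j \in I) /\ x = \prod_j a j).

Lemma genideal_closed (A : R -> Prop) : 1 \notin genideal A -> idealr_closed (genideal A).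
Proof.
move=> A1; split=> // [|a u v].
  by apply/asboolP; exists [::]; split=> //; rewrite big_nil.
move=> /asboolP [s [sA ->]] /asboolP [t [tA ->]]; apply/asboolP.
exists ([seq (a * x.1, x.2) | x <- s] ++ t); split.
  by move=> x; rewrite mem_cat => /orP[/mapP[y /sA ? ->]|/tA].
rewrite big_cat big_map /= mulr_sumr; congr (_ + _).
by apply: eq_bigr => x _; rewrite mulrA.
Qed.

Lemma genideal_sub (A : R -> Prop) (I : idealr R) :
  (forall x, A x -> x \in I) -> {subset genideal A <= I}.
Proof.
move=> AI x /asboolP [s [sA ->]]; rewrite big_seq; apply: rpred_sum => u us.
by rewrite idealMr //; exact/AI/sA.
Qed.

Lemma powideal_sub (I : idealr R) n : {subset powideal I n.+1 <= I}.
Proof.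
apply: genideal_sub => _ [a [aI ->]].
by rewrite big_ord_recl mulrC idealMr.
Qed.

End Ideals.

HB.instance Definition _ (R : comNzRingType) (I : idealr R) (n : nat) :=
  isIdealr.Build R (powideal I n.+1)
    (genideal_closed (contraFN (@powideal_sub R I n 1) (idealr1 I))).

(* {ideal_quot I} only has a ring structure; quotmod I is R/I as an R-module. *)
Section QuotientModule.
Variables (R : comNzRingType) (I : idealr R).

Definition quotmod : Type := {ideal_quot I}.

HB.instance Definition _ := GRing.Zmodule.on quotmod.

Definition quotmod_scale (r : R) (x : quotmod) : quotmod :=
  (\pi_({ideal_quot I}) r : {ideal_quot I}) * (x : {ideal_quot I}).

Lemma quotmod_scaleA a b v :
  quotmod_scale a (quotmod_scale b v) = quotmod_scale (a * b) v.
Proof. by rewrite /quotmod_scale rmorphM mulrA. Qed.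

Lemma quotmod_scale1 : left_id 1 quotmod_scale.
Proof. by move=> v; rewrite /quotmod_scale rmorph1 mul1r. Qed.

Lemma quotmod_scaleDr : right_distributive quotmod_scale +%R.
Proof. by move=> a u v; rewrite /quotmod_scale mulrDr. Qed.

Lemma quotmod_scaleDl v : {morph quotmod_scale^~ v : a b / a + b}.
Proof. by move=> a b; rewrite /quotmod_scale rmorphD mulrDl. Qed.

HB.instance Definition _ := GRing.Zmodule_isLmodule.Build R quotmod
  quotmod_scaleA quotmod_scale1 quotmod_scaleDr quotmod_scaleDl.

End QuotientModule.

Section InjectiveHull.
Variable R : comNzRingType.

Definition injective_module (E : lmodType R) : Prop :=
  forall (A B : lmodType R) (j : {linear A -> B}) (f : {linear A -> E}),
    injective j -> exists g : {linear B -> E}, forall a, g (j a) = f a.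

Definition essential (M E : lmodType R) (i : {linear M -> E}) : Prop :=
  forall N : {pred E}, submod_closed N ->
    (exists2 x, x \in N & x != 0) -> exists2 y, i y \in N & i y != 0.

Definition injective_hull (M E : lmodType R) (i : {linear M -> E}) : Prop :=
  [/\ injective i, essential i & injective_module E].

End InjectiveHull.

Section Completion.
Variables (R : comNzRingType) (I : idealr R).

(* The n-th component lives in R/I^(n+1): the zero ring R/I^0 contributes
   nothing to the inverse limit. *)
Notation Q n := {ideal_quot (powideal I n.+1)}.

(* The n-th and the (n+1)-st components are compatible when they have a common
   representative in R, i.e. when the latter is mapped to the former. *)
Record completion := Completion {
  cval : forall n, Q n;
  cvalP : forall n, exists r : R, cval n = \pi r /\ cval n.+1 = \pi r }.

Lemma cval_inj x y : (forall n, cval x n = cval y n) -> x = y.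
Proof.
case: x y => [x xP] [y yP] /= xy.
have {}xy : x = y by apply: functional_extensionality_dep.
by case: y / xy yP => yP; congr Completion; exact: Prop_irrelevance.
Qed.

HB.instance Definition _ := gen_eqMixin completion.
HB.instance Definition _ := gen_choiceMixin completion.

Definition to_completion (r : R) : completion :=
  @Completion (fun n => \pi r) (fun n => ex_intro _ r (conj erefl erefl)).

Lemma cadd_subproof (x y : completion) n : exists r : R,
  cval x n + cval y n = \pi r /\ cval x n.+1 + cval y n.+1 = \pi r.
Proof.
have [[a [-> ->]] [b [-> ->]]] := (cvalP x n, cvalP y n).
by exists (a + b); rewrite !rmorphD.
Qed.
Definition cadd x y := Completion (cadd_subproof x y).

Lemma copp_subproof (x : completion) n : exists r : R,
  - cval x n = \pi r /\ - cval x n.+1 = \pi r.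
Proof. by have [a [-> ->]] := cvalP x n; exists (- a); rewrite !rmorphN. Qed.
Definition copp x := Completion (copp_subproof x).

Lemma cmul_subproof (x y : completion) n : exists r : R,
  cval x n * cval y n = \pi r /\ cval x n.+1 * cval y n.+1 = \pi r.
Proof.
have [[a [-> ->]] [b [-> ->]]] := (cvalP x n, cvalP y n).
by exists (a * b); rewrite !rmorphM.
Qed.
Definition cmul x y := Completion (cmul_subproof x y).

Lemma caddA : associative cadd.
Proof. by move=> x y z; apply: cval_inj => n /=; rewrite addrA. Qed.
Lemma caddC : commutative cadd.
Proof. by move=> x y; apply: cval_inj => n /=; rewrite addrC. Qed.
Lemma cadd0 : left_id (to_completion 0) cadd.
Proof. by move=> x; apply: cval_inj => n /=; rewrite rmorph0 add0r. Qed.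
Lemma caddN : left_inverse (to_completion 0) copp cadd.
Proof. by move=> x; apply: cval_inj => n /=; rewrite rmorph0 addNr. Qed.

HB.instance Definition _ :=
  GRing.isZmodule.Build completion caddA caddC cadd0 caddN.

Lemma cmulA : associative cmul.
Proof. by move=> x y z; apply: cval_inj => n /=; rewrite mulrA. Qed.
Lemma cmulC : commutative cmul.
Proof. by move=> x y; apply: cval_inj => n /=; rewrite mulrC. Qed.
Lemma cmul1 : left_id (to_completion 1) cmul.
Proof. by move=> x; apply: cval_inj => n /=; rewrite rmorph1 mul1r. Qed.
Lemma cmulDl : left_distributive cmul +%R.
Proof. by move=> x y z; apply: cval_inj => n /=; rewrite mulrDl. Qed.
Lemma c1_neq0 : to_completion 1 != 0.
Proof.
apply/eqP => /(congr1 (fun x => cval x 0)) /= /eqP.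
by rewrite rmorph1 rmorph0 oner_eq0.
Qed.

HB.instance Definition _ := GRing.Zmodule_isComNzRing.Build completion
  cmulA cmulC cmul1 cmulDl c1_neq0.

End Completion.

Section FrobeniusOperators.
Variables (p : nat) (R : comNzRingType) (M : lmodType R).

Definition frobenius_op (e : nat) (phi : M -> M) : Prop :=
  {morph phi : x y / x + y} /\
  forall (r : R) (m : M), phi (r *: m) = r ^+ (p ^ e) *: phi m.

(* The direct sum of the additive groups F^e(M): finitely supported families. *)
Record frobring := Frobring {
  fval : nat -> M -> M;
  fvalP : forall e, frobenius_op e (fval e);
  ffin : exists N, forall e, (N <= e)%N -> forall m, fval e m = 0 }.

Lemma fval_inj x y : (forall e m, fval x e m = fval y e m) -> x = y.
Proof.
case: x y => [x xP xN] [y yP yN] /= xy.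
have {}xy : x = y by apply/funext => e; apply/funext => m; exact: xy.
by case: y / xy yP yN => yP yN; congr Frobring; exact: Prop_irrelevance.
Qed.

Lemma fvalD x e u v : fval x e (u + v) = fval x e u + fval x e v.
Proof. by case: (fvalP x e). Qed.
Lemma fvalZ x e r u : fval x e (r *: u) = r ^+ (p ^ e) *: fval x e u.
Proof. by case: (fvalP x e). Qed.
Lemma fval0 x e : fval x e 0 = 0.
Proof. by apply: (@addrI _ (fval x e 0)); rewrite -fvalD !addr0. Qed.
Lemma fval_sum x e (J : Type) (s : seq J) (P : pred J) (f : J -> M) :
  fval x e (\sum_(j <- s | P j) f j) = \sum_(j <- s | P j) fval x e (f j).
Proof. by apply: (big_morph _ (fvalD x e)); exact: fval0. Qed.

HB.instance Definition _ := gen_eqMixin frobring.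
HB.instance Definition _ := gen_choiceMixin frobring.

Lemma fzeroP e : frobenius_op e (fun=> 0).
Proof. by split=> [u v|r u]; rewrite ?addr0 ?scaler0. Qed.
Definition fzero : frobring :=
  @Frobring (fun _ _ => 0) fzeroP (ex_intro _ 0%N (fun _ _ _ => erefl)).

Lemma faddP x y e : frobenius_op e (fun m => fval x e m + fval y e m).
Proof. by split=> [u v|r u]; rewrite ?fvalD ?fvalZ ?scalerDr // addrACA. Qed.
Lemma fadd_fin x y :
  exists N, forall e, (N <= e)%N -> forall m, fval x e m + fval y e m = 0.
Proof.
have [[a xa] [b yb]] := (ffin x, ffin y); exists (maxn a b) => e.
by rewrite geq_max => /andP[ae be] m; rewrite xa // yb // addr0.
Qed.
Definition fadd x y := Frobring (faddP x y) (fadd_fin x y).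

Lemma foppP x e : frobenius_op e (fun m => - fval x e m).
Proof. by split=> [u v|r u]; rewrite ?fvalD ?fvalZ ?scalerN ?opprD. Qed.
Lemma fopp_fin x : exists N, forall e, (N <= e)%N -> forall m, - fval x e m = 0.
Proof.
by have [a xa] := ffin x; exists a => e ae m; rewrite xa // oppr0.
Qed.
Definition fopp x := Frobring (foppP x) (fopp_fin x).

Lemma faddA : associative fadd.
Proof. by move=> x y z; apply: fval_inj => e m /=; rewrite addrA. Qed.
Lemma faddC : commutative fadd.
Proof. by move=> x y; apply: fval_inj => e m /=; rewrite addrC. Qed.
Lemma fadd0 : left_id fzero fadd.
Proof. by move=> x; apply: fval_inj => e m /=; rewrite add0r. Qed.
Lemma faddN : left_inverse fzero fopp fadd.
Proof. by move=> x; apply: fval_inj => e m /=; rewrite addNr. Qed.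

HB.instance Definition _ :=
  GRing.isZmodule.Build frobring faddA faddC fadd0 faddN.

(* The bilinear extension of composition F^i(M) x F^j(M) -> F^(i+j)(M). *)
Definition fmul_fun (x y : frobring) (e : nat) (m : M) : M :=
  \sum_(i < e.+1) fval x i (fval y (e - i) m).

Lemma fmulP x y e : frobenius_op e (fmul_fun x y e).
Proof.
split=> [u v|r u]; rewrite /fmul_fun.
  by rewrite -big_split; apply: eq_bigr => i _; rewrite !fvalD.
rewrite scaler_sumr; apply: eq_bigr => i _.
by rewrite !fvalZ -exprM -expnD subnK // -ltnS.
Qed.
Lemma fmul_fin x y :
  exists N, forall e, (N <= e)%N -> forall m, fmul_fun x y e m = 0.
Proof.
have [[a xa] [b yb]] := (ffin x, ffin y); exists (a + b)%N => e abe m.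
rewrite /fmul_fun big1 // => i _; have [ai|ia] := leqP a i; first exact: xa.
rewrite yb ?fval0 // leq_subRL; last by rewrite -ltnS.
by apply: leq_trans abe; rewrite leq_add2r ltnW.
Qed.
Definition fmul x y := Frobring (fmulP x y) (fmul_fin x y).

Definition fone_fun (e : nat) (m : M) : M := if e == 0%N then m else 0.
Lemma foneP e : frobenius_op e (fone_fun e).
Proof.
by case: e => [|e]; split=> [u v|r u]; rewrite /fone_fun /= ?expn0 ?expr1 ?addr0 ?scaler0.
Qed.
Lemma fone_fin : exists N, forall e, (N <= e)%N -> forall m, fone_fun e m = 0.
Proof. by exists 1%N => -[]. Qed.
Definition fone := Frobring foneP fone_fin.

Lemma fmulA : associative fmul.
Proof.
move=> x y z; apply: fval_inj => e m /=; rewrite /fmul_fun /=.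
pose G i k := fval x i (fval y (k - i) (fval z (e - k) m)).
transitivity (\sum_(i < e.+1) \sum_(k < e.+1 | (i <= k)%N) G i k).
  apply: eq_bigr => i _; rewrite /fmul_fun fval_sum.
  have ie : (i <= e)%N by rewrite -ltnS.
  rewrite -(big_mkord (leq i) (G i)).
  transitivity (\sum_(i <= k < e.+1) G i k); last by rewrite (big_nat_widenl i 0).
  rewrite -[X in index_iota X _]add0n big_addn subSn // big_mkord.
  by apply: eq_bigr => j _; rewrite /G addnK subnDA subnAC.
rewrite (exchange_big_dep predT) //=; apply: eq_bigr => k _.
by rewrite (big_ord_narrow (ltn_ord k)).
Qed.

Lemma fmul1l : left_id fone fmul.
Proof.
move=> x; apply: fval_inj => e m /=.
by rewrite /fmul_fun big_ord_recl /= subn0 big1 ?addr0.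
Qed.
Lemma fmul1r : right_id fone fmul.
Proof.
move=> x; apply: fval_inj => e m /=.
rewrite /fmul_fun big_ord_recr /= subnn big1 ?add0r // => i _.
by rewrite /fone_fun subn_eq0 leqNgt ltn_ord fval0.
Qed.
Lemma fmulDl : left_distributive fmul +%R.
Proof.
move=> x y z; apply: fval_inj => e m /=.
by rewrite /fmul_fun -big_split; apply: eq_bigr.
Qed.
Lemma fmulDr : right_distributive fmul +%R.
Proof.
move=> x y z; apply: fval_inj => e m /=.
by rewrite /fmul_fun -big_split; apply: eq_bigr => i _; rewrite /= fvalD.
Qed.

HB.instance Definition _ := GRing.Zmodule_isPzRing.Build frobring
  fmulA fmul1l fmul1r fmulDl fmulDr.

(* F^0(M), embedded in F(M) as the families concentrated in degree 0 *)
Definition in_degree0 (x : frobring) : Prop :=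
  forall e, (0 < e)%N -> forall m, fval x e m = 0.

(* The subring generated by F^0(M) and s is the intersection of the subrings
   S containing both. *)
Definition finitely_generated_over_degree0 : Prop :=
  exists s : seq frobring, forall S : {pred frobring}, subring_closed S ->
    (forall x, in_degree0 x -> x \in S) -> {subset s <= S} ->
    forall x, x \in S.

End FrobeniusOperators.

Section DeterminantalRing.
Variable F : fieldType.

Definition indet : 'M[{mpoly F[2 * 3]}]_(2, 3) :=
  \matrix_(i, j) 'X_(mxvec_index i j).

Definition minors_ideal : {pred {mpoly F[2 * 3]}} :=
  genideal (fun x => exists (f : 'I_2 -> 'I_2) (g : 'I_2 -> 'I_3),
    [/\ {homo f : i j / (i < j)%N}, {homo g : i j / (i < j)%N} &
        x = \det (mxsub f g indet)]).

Definition eval0 : {mpoly F[2 * 3]} -> F := meval (fun=> 0).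
HB.instance Definition _ := GRing.RMorphism.on eval0.

Lemma eval0_indet i j : eval0 (indet i j) = 0.
Proof. by rewrite mxE /eval0 mevalXU. Qed.

Lemma eval0_minors x : x \in minors_ideal -> eval0 x = 0.
Proof.
move=> /asboolP [s [sA ->]]; rewrite rmorph_sum big_seq big1 // => u us.
have [f [g [_ _ ->]]] := sA _ us.
rewrite rmorphM -det_map_mx (_ : map_mx _ _ = 0) ?det0 ?mulr0 //.
by apply/matrixP => i j; rewrite !mxE -(eval0_indet (f i) (g j)) mxE.
Qed.

Lemma minors_ideal_proper : 1 \notin minors_ideal.
Proof.
by apply/negP => /eval0_minors /eqP; rewrite rmorph1 oner_eq0.
Qed.

HB.instance Definition _ := isIdealr.Build {mpoly F[2 * 3]} minors_ideal
  (genideal_closed minors_ideal_proper).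

Definition detring : Type := {ideal_quot minors_ideal}.
HB.instance Definition _ := GRing.ComNzRing.on detring.

Definition to_detring (x : {mpoly F[2 * 3]}) : detring :=
  \pi_({ideal_quot minors_ideal}) x.
Lemma to_detring_is_zmod_morphism : zmod_morphism to_detring.
Proof. by move=> x y; rewrite /to_detring rmorphB. Qed.
Lemma to_detring_is_monoid_morphism : monoid_morphism to_detring.
Proof. by split=> [|x y]; rewrite /to_detring ?rmorph1 ?rmorphM. Qed.
HB.instance Definition _ := GRing.isZmodMorphism.Build _ _ to_detring
  to_detring_is_zmod_morphism.
HB.instance Definition _ := GRing.isMonoidMorphism.Build _ _ to_detring
  to_detring_is_monoid_morphism.

Definition hommax : {pred detring} :=
  genideal (fun x => exists i j, x = to_detring (indet i j)).

Lemma hommax_proper : 1 \notin hommax.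
Proof.
have piE (r r' : {mpoly F[2 * 3]}) :
    to_detring r = to_detring r' -> eval0 r = eval0 r'.
  move=> /eqP; rewrite -Quotient.idealrBE => /eval0_minors /eqP.
  by rewrite rmorphB subr_eq0 => /eqP.
have pi_surj (x : detring) : exists r, x = to_detring r.
  by exists (repr (x : {ideal_quot minors_ideal})); rewrite /to_detring reprK.
suff ev x : x \in hommax -> exists2 r, x = to_detring r & eval0 r = 0.
  apply/negP => /ev [r]; rewrite -(rmorph1 to_detring) => /piE.
  by rewrite rmorph1 => <- /eqP; rewrite oner_eq0.
move=> /asboolP [s [sA ->]] {x}; elim: s sA => [|u s IHs] sA.
  by exists 0; rewrite ?big_nil rmorph0.
have [|r Er r0] := IHs; first by move=> v vs; apply: sA; rewrite inE vs orbT.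
have [|i [j Eu]] := sA u; first exact: mem_head.
have [a Ea] := pi_surj u.1; exists (a * indet i j + r).
  by rewrite big_cons Er Eu Ea rmorphD rmorphM.
by rewrite rmorphD rmorphM [X in _ * X]eval0_indet mulr0 [LHS]add0r.
Qed.

HB.instance Definition _ := isIdealr.Build detring hommax
  (genideal_closed hommax_proper).

End DeterminantalRing.

Arguments minors_ideal : clear implicits.
Arguments hommax : clear implicits.

(* Main.v *)
Require Import Defs.
From HB Require Import structures.
From mathcomp Require Import all_boot all_order all_algebra.
From mathcomp Require Import generic_quotient ring_quotient.
From mathcomp Require Import boolp mpoly.
From mathcomp Require Import ssrcomplements zify ring.

Set Implicit Arguments.
Unset Strict Implicit.
Unset Printing Implicit Defensive.

Import GRing.Theory.
Local Open Scope ring_scope.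

(** Write R for the determinantal ring and q for p^e. The map x_ij |-> s_i t_j
    identifies R with the span, in the polynomial ring in s_0, s_1 and
    t_0, t_1, t_2, of the monomials of equal degree in s and in t ([segreK]).

    The hull E becomes explicit: it is the module of functionals on these
    monomials that vanish in large degree, on which R acts by translating the
    exponents ([hull_cover]). Since E is injective, the inclusion of the residue
    field extends to a map from all functionals to E. On functionals of bounded
    degree it is injective, because each nonzero one has a nonzero multiple in the
    socle;
    it is onto, because R is noetherian ([noetherian_poly]), so that every
    element of E is killed by a power of the maximal ideal ([hull_torsion]) and
    is reached by induction on that power ([cover_surj]).

    Endomorphisms: an R-linear map phi on E is determined by the functional
    x |-> phi(x)(1), and the values of the latter on the functionals dual to
    the monomials are the coefficients of the element of the completion by which
    phi acts ([endo_compl_act], [matlis]).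

    Finite generation: it would make every operator of large degree e a sum of
    products of operators of smaller positive degrees
    ([finitely_generated_decomposable]). Let w = (w_0, w_1, w_2) have sum q - 1.
    Taking the dual of s^a t^b to the dual of s^(qa + q - 1) t^(qb + q - 1 - w)
    defines an operator of degree e ([twisted_operator]). An operator of degree e
    can only take the dual of x^m to duals of monomials with exponents
    less than q (m + 1), in every variable ([operator_support]). If a product of
    operators of degrees i and j, with i + j = e, takes the socle to something
    involving the dual of s^(q - 1) t^(q - 1 - w), then this bound forces
    w >= p^i v for some v with sum p^j - 1; hence adding the three parts of w in
    base p carries nothing from the lowest i digits. For
    w = (p^(e-1) - 1, (p - 1) p^(e-1) - 1, 1) there is a carry out of every digit
    but the top one, so that the corresponding operator is not a sum of such
    products ([product_vanishes]). *)

(** * Noetherian rings *)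

Section Noetherian.

Definition ideal_pred (A : comNzRingType) (J : A -> Prop) : Prop :=
  J 0 /\ forall a u v, J u -> J v -> J (a * u + v).

Definition noetherian (A : comNzRingType) : Prop :=
  forall J : nat -> A -> Prop, (forall n, ideal_pred (J n)) ->
    (forall n x, J n x -> J n.+1 x) ->
    exists N, forall n x, J n x -> J N x.

Lemma chain_le (T : Type) (J : nat -> T -> Prop) :
  (forall n x, J n x -> J n.+1 x) ->
  forall m n x, (m <= n)%N -> J m x -> J n x.
Proof.
move=> Jm m n x; elim: n => [|n IHn]; first by rewrite leqn0 => /eqP ->.
by rewrite leq_eqVlt => /orP[/eqP -> //|mn] Jx; apply/Jm/IHn.
Qed.

Lemma noetherian_field (F : fieldType) : noetherian F.
Proof.
move=> J Ji Jm; have [[N [x [Jx x0]]]|none] :=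
    pselect (exists N x, J N x /\ x != 0).
  exists N => n y _; have [J0 JD] := Ji N.
  by have := JD (y / x) x 0 Jx J0; rewrite divfK // addr0.
exists 0%N => n y Jy; have [-> | y0] := eqVneq y 0; first by case: (Ji 0%N).
by case: none; exists n, y.
Qed.

Lemma noetherian_surj (A B : comNzRingType) (f : {rmorphism A -> B}) :
  (forall b, exists a, f a = b) -> noetherian A -> noetherian B.
Proof.
move=> f_surj nA J Ji Jm.
have [n|n a|N JN] := nA (fun n a => J n (f a)); last 2 first.
- exact: Jm.
- by exists N => n b; have [a <-] := f_surj b; apply: JN.
have [J0 JD] := Ji n; split; first by rewrite rmorph0.
by move=> a u v Ju Jv; rewrite rmorphD rmorphM; apply: JD.
Qed.

(** The leading-coefficient argument: the ideals of coefficients in degree [d]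
    of polynomials of degree at most [d] grow both with [d] and along the
    chain, so they are all constant from some index on; a polynomial of the
    chain is then reduced degree by degree. *)
Lemma noetherian_poly (A : comNzRingType) :
  noetherian A -> noetherian {poly A}.
Proof.
move=> nA J Ji Jm.
pose L d n a := exists p, [/\ J n p, (size p <= d.+1)%N & p`_d = a].
have JB n u v : J n u -> J n v -> J n (u - v).
  by have [J0 JD] := Ji n => Ju Jv; rewrite addrC -mulN1r; apply: JD.
have Li d n : ideal_pred (L d n).
  have [J0 JD] := Ji n; split; first by exists 0; rewrite size_poly0 coef0.
  move=> a _ _ [p [Jp sp <-]] [q [Jq sq <-]]; exists (a%:P * p + q).
  split; [exact: JD | | by rewrite coefD coefCM].
  apply: leq_trans (size_polyD _ _) _; rewrite geq_max sq andbT.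
  by rewrite mul_polyC; apply: leq_trans (size_scale_leq _ _) sp.
have Lm d n a : L d n a -> L d n.+1 a.
  by case=> p [Jp sp pa]; exists p; split=> //; apply: Jm.
have LS d n a : L d n a -> L d.+1 n a.
  case=> p [Jp sp pa]; have [J0 JD] := Ji n; exists ('X * p + 0).
  split; [exact: JD | | by rewrite addr0 coefXM].
  by rewrite addr0 mulrC (leq_trans (size_polyMleq _ _)) // size_polyX addn2.
have [k|k a|K KP] := nA (fun k => L k k); [exact: Li | by move=> /LS /Lm | ].
have /choice [N NP] : forall d, exists N, forall n a, L d n a -> L d N a.
  by move=> d; apply: nA => [n|n a]; [exact: Li | exact: Lm].
pose M := (K + \sum_(d < K) N d)%N; exists M.
have LM d n a : L d n a -> L d M a.
  move=> La; have [dK|Kd] := ltnP d K.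
    apply: (chain_le (Lm d) _ (NP _ _ _ La)).
    by rewrite /M (bigD1 (Ordinal dK)) //= addnCA leq_addr.
  have {}La : L K K a.
    apply: (KP (maxn d n)); apply: (chain_le (Lm _) (leq_maxr d n)).
    exact: (chain_le (J := fun k b => L k n b) (fun k b => @LS k n b) (leq_maxl d n)).
  apply: (chain_le (Lm _) (leq_addr _ _)).
  exact: (chain_le (J := fun k b => L k K b) (fun k b => @LS k K b) Kd).
move=> n p; move: {2}(size p) (leqnn (size p)) => s.
elim: s n p => [|s IHs] n p sp Jp.
  by move: sp; rewrite leqn0 size_poly_eq0 => /eqP ->; case: (Ji M).
have [q [Jq sq qp]] : L s M p`_s by apply: (LM _ n); exists p.
have pq : J M (p - q).
  apply: (IHs (maxn n M)); last first.
    by apply: JB; [apply: chain_le (leq_maxl _ _) Jp|apply: chain_le (leq_maxr _ _) Jq].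
  apply/leq_sizeP => j; rewrite leq_eqVlt => /orP[/eqP <-|sj].
    by rewrite coefB qp subrr.
  by rewrite coefB !nth_default ?subrr // (leq_trans _ sj).
by have [J0 JD] := Ji M; have := JD 1 _ _ pq Jq; rewrite mul1r subrK.
Qed.

(** Adjoining finitely many elements, one polynomial variable for each. *)
Lemma noetherian_adjoin (A S : comNzRingType) (f : {rmorphism A -> S})
    (xs : seq S) : noetherian A ->
  exists (B : comNzRingType) (g : {rmorphism B -> S}),
    [/\ noetherian B, forall a, exists b, g b = f a &
        forall x, x \in xs -> exists b, g b = x].
Proof.
move=> nA; elim: xs => [|x xs [B [g [nB gf gxs]]]].
  by exists A, f; split=> // a; exists a.
have gx : commr_rmorph g x by move=> b; apply: mulrC.
exists {poly B}, (horner_morph gx); split; first exact: noetherian_poly.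
  by move=> a; have [b <-] := gf a; exists b%:P; exact: horner_morphC.
move=> y; rewrite inE => /orP[/eqP ->|/gxs [b <-]].
  by exists 'X; exact: horner_morphX.
by exists b%:P; exact: horner_morphC.
Qed.

End Noetherian.

(** * Products of entries of the generic matrix *)

Lemma det_mx2 (A : comNzRingType) (M : 'M[A]_2) :
  \det M = M 0 0 * M 1 1 - M 0 1 * M 1 0.
Proof.
rewrite (expand_det_row _ 0) !big_ord_recl big_ord0 addr0 /cofactor !det_mx11 !mxE.
rewrite /= expr0 expr1 mul1r mulN1r mulrN.
by congr (M _ _ * M _ _ - M _ _ * M _ _); apply: val_inj.
Qed.

Lemma det_mxsub2 (A : comNzRingType) m n (f : 'I_2 -> 'I_m) (g : 'I_2 -> 'I_n)
    (M : 'M[A]_(m, n)) :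
  \det (mxsub f g M) = M (f 0) (g 0) * M (f 1) (g 1) - M (f 0) (g 1) * M (f 1) (g 0).
Proof. by rewrite det_mx2 !mxE. Qed.

Section Segre.
Variable F : fieldType.
Local Notation R := (detring F).
Local Notation pos := ('I_2 * 'I_3)%type.
Local Notation mono := 'X_{1..2 + 3}.

Definition const (c : F) : R := to_detring c%:MP.
Lemma const_is_zmod_morphism : zmod_morphism const.
Proof. by move=> c d; rewrite /const mpolyCB rmorphB. Qed.
Lemma const_is_monoid_morphism : monoid_morphism const.
Proof. by split=> [|c d]; rewrite /const ?mpolyC1 ?mpolyCM (rmorph1, rmorphM). Qed.
HB.instance Definition _ :=
  GRing.isZmodMorphism.Build F R const const_is_zmod_morphism.
HB.instance Definition _ :=
  GRing.isMonoidMorphism.Build F R const const_is_monoid_morphism.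

Definition entry (u : pos) : R := to_detring (indet F u.1 u.2).
Definition wprod (L : seq pos) : R := \prod_(u <- L) entry u.

Lemma to_detring_surj (r : R) : exists f, r = to_detring f.
Proof. by exists (repr (r : {ideal_quot (minors_ideal F)})); rewrite /to_detring reprK. Qed.

Lemma detring_ind (P : R -> Prop) :
  (forall c, P (const c)) -> (forall u, P (entry u)) ->
  (forall r s, P r -> P s -> P (r + s)) ->
  (forall r s, P r -> P s -> P (r * s)) -> forall r, P r.
Proof.
move=> Pc Pe PD PM r; have [f ->] := to_detring_surj r.
have P0 : P 0 by rewrite -(rmorph0 const).
have P1 : P 1 by rewrite -(rmorph1 const).
have PX (k : 'I_(2 * 3)) : P (to_detring 'X_k).
  by case/mxvec_indexP: k => i j; have := Pe (i, j); rewrite /entry mxE.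
rewrite [f]mpolyE rmorph_sum; apply: big_ind => // m _.
rewrite -mul_mpolyC rmorphM; apply: (PM); first exact: Pc.
rewrite mpolyXE_id rmorph_prod; apply: big_ind => // k _.
rewrite rmorphXn; move: (m k) => n; elim: n => [|n IHn]; first by rewrite expr0.
by rewrite exprS; apply: PM => //; apply: PX.
Qed.

Lemma minor_mem (f : 'I_2 -> 'I_2) (g : 'I_2 -> 'I_3) :
    {homo f : i j / (i < j)%N} -> {homo g : i j / (i < j)%N} ->
  \det (mxsub f g (indet F)) \in minors_ideal F.
Proof.
move=> hf hg; apply/asboolP; exists [:: (1, \det (mxsub f g (indet F)))].
split; last by rewrite big_seq1 mul1r.
by move=> u; rewrite inE => /eqP -> /=; exists f, g.
Qed.

Lemma entry_swap i j i' j' :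
  entry (i, j) * entry (i', j') = entry (i, j') * entry (i', j).
Proof.
wlog ii' : i i' / (i < i')%N => [IH|].
  have [/IH //|/IH|ii'] := ltngtP i i'; first by rewrite mulrC => ->; rewrite mulrC.
  by rewrite (val_inj ii') mulrC.
wlog jj' : j j' / (j < j')%N => [IH|].
  by have [/IH //|/IH //|jj'] := ltngtP j j'; rewrite (val_inj jj').
pose pick n (a b : 'I_n) (k : 'I_2) := if k == 0 then a else b.
have pick_homo n (a b : 'I_n) : (a < b)%N -> {homo pick n a b : k l / (k < l)%N}.
  by move=> ab [[|[|k]] // hk] [[|[|l]] // hl].
have := minor_mem (pick_homo _ _ _ ii') (pick_homo _ _ _ jj').
rewrite det_mxsub2 Quotient.idealrBE => /eqP.
by rewrite /entry -!rmorphM.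
Qed.

Definition bidegree (u : pos) : mono := (U_(lshift 3 u.1) + U_(rshift 2 u.2))%MM.
Definition margin (L : seq pos) : mono := (\sum_(u <- L) bidegree u)%MM.

Lemma margin_cons u L : margin (u :: L) = (bidegree u + margin L)%MM.
Proof. exact: big_cons. Qed.

Lemma bidegree_l u i : bidegree u (lshift 3 i) = (u.1 == i).
Proof. by rewrite mnmDE !mnm1E eq_lshift eq_rlshift addn0. Qed.
Lemma bidegree_r u j : bidegree u (rshift 2 j) = (u.2 == j).
Proof. by rewrite mnmDE !mnm1E eq_rshift eq_lrshift. Qed.

Lemma margin_l L i : margin L (lshift 3 i) = count_mem i (map fst L).
Proof.
elim: L => [|u L IHL]; first by rewrite /margin big_nil mnm0E.
by rewrite margin_cons mnmDE IHL bidegree_l.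
Qed.
Lemma margin_r L j : margin L (rshift 2 j) = count_mem j (map snd L).
Proof.
elim: L => [|u L IHL]; first by rewrite /margin big_nil mnm0E.
by rewrite margin_cons mnmDE IHL bidegree_r.
Qed.

Lemma margin_perm L L' : perm_eq L L' -> margin L = margin L'.
Proof. exact: perm_big. Qed.
Lemma wprod_perm L L' : perm_eq L L' -> wprod L = wprod L'.
Proof. exact: perm_big. Qed.

(** By the vanishing of the minors, two factors may exchange their column
    indices; so any letter of the first word can be produced in the second
    one, and cancelled. *)
Lemma wprod_margin L L' : margin L = margin L' -> wprod L = wprod L'.
Proof.
elim: L L' => [|[i j] L IHL] L' eqm.
  case: L' eqm => [|u L'] //; rewrite margin_cons /margin big_nil => /eqP.
  by rewrite eq_sym mnmD_eq0 /bidegree mnmD_eq0 mnm1_eq0.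
have [u1L u2L] : i \in map fst L' /\ j \in map snd L'.
  rewrite -!has_pred1 !has_count -margin_l -margin_r -eqm !margin_cons.
  by rewrite mnmDE bidegree_l mnmDE bidegree_r /= !eqxx.
case/mapP: u1L => [[i0 j'] uL /= ?]; subst i0.
have := perm_to_rem uL; set L1 := rem _ _ => permL'.
have [jj'|jj'] := eqVneq j j'.
  move: eqm; rewrite (margin_perm permL') (wprod_perm permL') !margin_cons -jj'.
  by move=> /addmI /IHL; rewrite /wprod !big_cons => ->.
have /mapP[[i' j0] vL /= ?] : j \in map snd L1; last subst j0.
  by move: u2L; rewrite (perm_mem (perm_map snd permL')) inE (negPf jj').
have := perm_to_rem vL; set L2 := rem _ _ => permL1.
have permL : perm_eq L' [:: (i, j'), (i', j) & L2].
  by apply: perm_trans permL' _; rewrite perm_cons.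
rewrite (wprod_perm permL) /wprod !big_cons mulrA entry_swap -mulrA.
congr (_ * _); transitivity (wprod ((i', j') :: L2)); last exact: big_cons.
apply: IHL.
move: eqm; rewrite (margin_perm permL) !margin_cons => eqm.
apply: (@addmI _ (bidegree (i, j))); rewrite eqm.
by apply/mnmP => k; rewrite /bidegree !mnmDE /=; lia.
Qed.
End Segre.

(** * Linear extension of functions on monomials *)

Section LinearExtension.
Variables (n : nat) (F A : comNzRingType) (phi : {rmorphism F -> A}).
Implicit Types (h : 'X_{1..n} -> A) (f g : {mpoly F[n]}).

Definition linext h f : A := \sum_(m <- msupp f) phi f@_m * h m.

Lemma linextE h f k : (msize f <= k)%N ->
  linext h f = \sum_(m : 'X_{1..n < k}) phi f@_m * h m.
Proof.
move=> fk; set I : subFinType _ := 'X_{1..n < k}.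
rewrite /linext (big_mksub I) ?msupp_uniq //=; last first.
  by move=> x /msize_mdeg_lt /leq_trans; apply.
rewrite big_rmcond //= => j /memN_msupp_eq0 ->.
by rewrite rmorph0 mul0r.
Qed.

Lemma linext_is_zmod_morphism h : zmod_morphism (linext h).
Proof.
move=> f g; pose k := maxn (msize (f - g)) (maxn (msize f) (msize g)).
rewrite !(@linextE h _ k) ?leq_max ?leqnn ?orbT // -sumrB.
by apply: eq_bigr => m _; rewrite mcoeffB rmorphB mulrBl.
Qed.
HB.instance Definition _ h := GRing.isZmodMorphism.Build {mpoly F[n]} A
  (linext h) (linext_is_zmod_morphism h).

Lemma linextX h m : linext h 'X_[m] = h m.
Proof. by rewrite /linext msuppX big_seq1 mcoeffX eqxx rmorph1 mul1r. Qed.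

Lemma linextC h c : linext h c%:MP = phi c * h 0%MM.
Proof.
have [->|c0] := eqVneq c 0; first by rewrite mpolyC0 raddf0 rmorph0 mul0r.
by rewrite /linext msuppC (negPf c0) big_seq1 mcoeffC eqxx mulr1.
Qed.

Lemma linextZ h c f : linext h (c *: f) = phi c * linext h f.
Proof.
pose k := maxn (msize (c *: f)) (msize f).
rewrite !(@linextE h _ k) ?leq_max ?leqnn ?orbT // mulr_sumr.
by apply: eq_bigr => m _; rewrite mcoeffZ rmorphM mulrA.
Qed.

Lemma linextD h h' f : linext (fun m => h m + h' m) f = linext h f + linext h' f.
Proof. by rewrite /linext -big_split; apply: eq_bigr => m _; rewrite mulrDr. Qed.

Lemma eq_linext h h' f : (forall m, m \in msupp f -> h m = h' m) ->
  linext h f = linext h' f.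
Proof. by move=> hh'; apply: eq_big_seq => m /hh' ->. Qed.

Lemma linext_eq0 h f : (forall m, m \in msupp f -> h m = 0) -> linext h f = 0.
Proof. by move=> h0; rewrite /linext big_seq big1 // => m /h0 ->; rewrite mulr0. Qed.

Lemma linextM h f g :
  linext h (f * g) = linext (fun m => linext (fun k => h (m + k)%MM) g) f.
Proof.
rewrite [in LHS](mpolyE f) mulr_suml raddf_sum; apply: eq_bigr => m _.
rewrite -scalerAl [LHS]linextZ; congr (_ * _).
rewrite [in LHS](mpolyE g) mulr_sumr raddf_sum; apply: eq_bigr => k _.
by rewrite -scalerAr [LHS]linextZ -mpolyXD linextX.
Qed.

End LinearExtension.

(** * The Segre embedding *)

Section SegreEmbedding.
Variable F : fieldType.
Local Notation R := (detring F).
Local Notation pos := ('I_2 * 'I_3)%type.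
Local Notation mono := 'X_{1..2 + 3}.
Local Notation S := {mpoly F[2 + 3]}.

(** The exponents of s come first, then those of t. *)
Definition segre_poly : {mpoly F[2 * 3]} -> S :=
  mmap (@mpolyC (2 + 3) F)
    (fun k => 'X_[mxvec (\matrix_(i < 2, j < 3) bidegree (i, j)) 0 k]).
HB.instance Definition _ := GRing.RMorphism.on segre_poly.

Lemma segre_poly_indet i j : segre_poly (indet F i j) = 'X_[bidegree (i, j)].
Proof. by rewrite mxE /segre_poly mmapX mmap1U mxvecE mxE. Qed.

Lemma segre_poly_minors f : f \in minors_ideal F -> segre_poly f = 0.
Proof.
move=> /asboolP [s [sA ->]]; rewrite rmorph_sum big_seq big1 // => u us.
have [h [g [_ _ ->]]] := sA _ us.
rewrite rmorphM det_mxsub2 rmorphB !rmorphM /=.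
rewrite !segre_poly_indet -!mpolyXD.
rewrite (_ : (_ + _)%MM = (bidegree (h 0%R, g 1%R) + bidegree (h 1%R, g 0%R))%MM).
  by rewrite subrr mulr0.
by apply/mnmP => k; rewrite /bidegree !mnmDE /=; lia.
Qed.

Definition segre (r : R) : S := segre_poly (repr (r : {ideal_quot (minors_ideal F)})).

Lemma segre_to_detring f : segre (to_detring f) = segre_poly f.
Proof.
apply/eqP; rewrite -subr_eq0 -rmorphB; apply/eqP/segre_poly_minors.
by rewrite Quotient.idealrBE reprK.
Qed.

Lemma segre_is_zmod_morphism : zmod_morphism segre.
Proof.
move=> r s; have [[f ->] [g ->]] := (to_detring_surj r, to_detring_surj s).
by rewrite -rmorphB !segre_to_detring rmorphB.
Qed.
Lemma segre_is_monoid_morphism : monoid_morphism segre.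
Proof.
split=> [|r s]; first by rewrite -(rmorph1 (@to_detring F)) segre_to_detring rmorph1.
have [[f ->] [g ->]] := (to_detring_surj r, to_detring_surj s).
by rewrite -rmorphM !segre_to_detring rmorphM.
Qed.
HB.instance Definition _ :=
  GRing.isZmodMorphism.Build R S segre segre_is_zmod_morphism.
HB.instance Definition _ :=
  GRing.isMonoidMorphism.Build R S segre segre_is_monoid_morphism.

Lemma segre_const c : segre (const c) = c%:MP.
Proof. by rewrite segre_to_detring /segre_poly mmapC. Qed.

Lemma segre_entry u : segre (entry F u) = 'X_[bidegree u].
Proof. by rewrite segre_to_detring segre_poly_indet; case: u. Qed.

Lemma segre_wprod L : segre (wprod F L) = 'X_[margin L].
Proof.
elim: L => [|u L IHL].
  by rewrite /wprod /margin !big_nil rmorph1 mpolyX0.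
by rewrite /wprod big_cons rmorphM /= segre_entry IHL margin_cons mpolyXD.
Qed.

Lemma wprod_cons u L : wprod F (u :: L) = entry F u * wprod F L.
Proof. exact: big_cons. Qed.
Lemma wprod_cat L L' : wprod F (L ++ L') = wprod F L * wprod F L'.
Proof. exact: big_cat. Qed.

Lemma detring_span r : exists s : seq (F * seq pos),
  r = \sum_(x <- s) const x.1 * wprod F x.2.
Proof.
elim/detring_ind: r => [c|u|_ _ [s ->] [t ->]|_ _ [s ->] [t ->]].
- by exists [:: (c, [::])]; rewrite big_seq1 /wprod big_nil mulr1.
- by exists [:: (1, [:: u])]; rewrite big_seq1 /wprod big_seq1 rmorph1 mul1r.
- by exists (s ++ t); rewrite big_cat.
exists [seq (x.1 * y.1, x.2 ++ y.2) | x <- s, y <- t].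
rewrite mulr_suml big_allpairs_dep; apply: eq_bigr => x _.
rewrite mulr_sumr; apply: eq_bigr => y _ /=.
by rewrite wprod_cat rmorphM mulrACA.
Qed.

Definition sdeg (m : mono) : nat := \sum_(i < 2) m (lshift 3 i).
Definition tdeg (m : mono) : nat := \sum_(j < 3) m (rshift 2 j).
Definition balanced (m : mono) : bool := sdeg m == tdeg m.

Lemma sdegD m m' : sdeg (m + m')%MM = (sdeg m + sdeg m')%N.
Proof. by rewrite /sdeg -big_split; apply: eq_bigr => i _; rewrite mnmDE. Qed.
Lemma tdegD m m' : tdeg (m + m')%MM = (tdeg m + tdeg m')%N.
Proof. by rewrite /tdeg -big_split; apply: eq_bigr => i _; rewrite mnmDE. Qed.
Lemma mdeg_sdeg m : mdeg m = (sdeg m + tdeg m)%N.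
Proof. by rewrite mdegE big_split_ord. Qed.

Lemma sdeg_bidegree u : sdeg (bidegree u) = 1%N.
Proof.
rewrite /sdeg (bigD1 u.1) //= bidegree_l eqxx big1 // => i iu.
by rewrite bidegree_l eq_sym (negPf iu).
Qed.
Lemma tdeg_bidegree u : tdeg (bidegree u) = 1%N.
Proof.
rewrite /tdeg (bigD1 u.2) //= bidegree_r eqxx big1 // => i iu.
by rewrite bidegree_r eq_sym (negPf iu).
Qed.
Lemma sdeg0 : sdeg 0%MM = 0%N.
Proof. by rewrite /sdeg big1 // => i _; rewrite mnm0E. Qed.
Lemma tdeg0 : tdeg 0%MM = 0%N.
Proof. by rewrite /tdeg big1 // => i _; rewrite mnm0E. Qed.

Lemma sdeg_margin L : sdeg (margin L) = size L.
Proof.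
elim: L => [|u L IHL]; first by rewrite /margin big_nil sdeg0.
by rewrite margin_cons sdegD sdeg_bidegree IHL.
Qed.
Lemma tdeg_margin L : tdeg (margin L) = size L.
Proof.
elim: L => [|u L IHL]; first by rewrite /margin big_nil tdeg0.
by rewrite margin_cons tdegD tdeg_bidegree IHL.
Qed.

Lemma balanced_margin L : balanced (margin L).
Proof. by rewrite /balanced sdeg_margin tdeg_margin. Qed.
Lemma balanced0 : balanced 0%MM.
Proof. by rewrite /balanced sdeg0 tdeg0. Qed.
Lemma balanced_bidegree u : balanced (bidegree u).
Proof. by rewrite /balanced sdeg_bidegree tdeg_bidegree. Qed.
Lemma balancedDl m m' : balanced m -> balanced (m + m')%MM = balanced m'.
Proof. by rewrite /balanced sdegD tdegD => /eqP ->; rewrite eqn_add2l. Qed.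
Lemma balancedDr m m' : balanced m -> balanced (m' + m)%MM = balanced m'.
Proof. by rewrite addmC => /balancedDl ->. Qed.
Lemma balanced_sdeg0 m : balanced m -> sdeg m = 0%N -> m = 0%MM.
Proof. by move=> /eqP bm s0; apply/eqP; rewrite -mdeg_eq0 mdeg_sdeg -bm s0. Qed.

Lemma marginP m : reflect (exists L, margin L = m) (balanced m).
Proof.
apply: (iffP idP) => [|[L <-]]; last exact: balanced_margin.
move: {2}(sdeg m) (erefl (sdeg m)) => d; elim: d m => [|d IHd] m dm bm.
  by exists [::]; rewrite /margin big_nil (balanced_sdeg0 bm).
have [i mi] : exists i, (0 < m (lshift 3 i))%N.
  apply: contrapT => none; move: dm; rewrite /sdeg big1 // => i _; apply/eqP.
  by rewrite -leqn0 leqNgt; apply/negP => mi; apply: none; exists i.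
have [j mj] : exists j, (0 < m (rshift 2 j))%N.
  apply: contrapT => none; move: dm; rewrite (eqP bm) /tdeg big1 // => j _.
  by apply/eqP; rewrite -leqn0 leqNgt; apply/negP => mj; apply: none; exists j.
have mE : m = (bidegree (i, j) + (m - bidegree (i, j)))%MM.
  rewrite addmC submK //; apply/mnm_lepP => k; case: (split_ordP k) => l -> /=.
    by rewrite bidegree_l /=; case: eqP => [<-|].
  by rewrite bidegree_r /=; case: eqP => [<-|].
have [||L LE] := IHd (m - bidegree (i, j))%MM.
- by move: dm; rewrite {1}mE sdegD sdeg_bidegree => -[].
- by move: bm; rewrite {1}mE balancedDl // balanced_bidegree.
by exists ((i, j) :: L); rewrite margin_cons LE -mE.
Qed.

(** The element of the ring with given exponents in s and t; by [wprod_margin]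
    the choice of a word is irrelevant. *)
Definition chi (m : mono) : R :=
  if pselect (exists L, margin L = m) is left ex then wprod F (projT1 (cid ex)) else 0.

Lemma chi_margin L : chi (margin L) = wprod F L.
Proof.
rewrite /chi; case: pselect => [ex|[]]; last by exists L.
by case: cid => L' /= /wprod_margin.
Qed.

Lemma segre_chi m : balanced m -> segre (chi m) = 'X_[m].
Proof. by move=> /marginP [L <-]; rewrite chi_margin segre_wprod. Qed.

(** The inverse of [segre] on its image: both sides agree on the products of
    entries, which span the ring. *)
Lemma segreK r : r = linext (@const F) chi (segre r).
Proof.
have [s ->] := detring_span r; rewrite rmorph_sum raddf_sum; apply: eq_bigr => x _ /=.
by rewrite rmorphM /= segre_const mul_mpolyC linextZ segre_wprod linextX chi_margin.
Qed.

Lemma segre_balanced r m : ~~ balanced m -> (segre r)@_m = 0.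
Proof.
move=> bm; have [s ->] := detring_span r; rewrite rmorph_sum raddf_sum big1 // => x _.
rewrite rmorphM /= segre_const segre_wprod mcoeffCM mcoeffX.
by case: eqP bm => [<-|]; rewrite ?balanced_margin // mulr0.
Qed.

End SegreEmbedding.

(** * Powers of the homogeneous maximal ideal *)

Section PowersOfMaximalIdeal.
Variable F : fieldType.
Local Notation R := (detring F).
Local Notation pos := ('I_2 * 'I_3)%type.
Local Notation mono := 'X_{1..2 + 3}.
Local Notation S := {mpoly F[2 + 3]}.

(** The degree in s suffices, as it is the degree in t for elements of the ring. *)
Definition order_ge (n : nat) (f : S) : Prop :=
  forall m, (sdeg m < n)%N -> f@_m = 0.

Lemma order_geM a b f g : order_ge a f -> order_ge b g -> order_ge (a + b) (f * g).
Proof.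
move=> fa gb m mab; rewrite mcoeffM big1 // => k /eqP mk.
have [ka|ak] := ltnP (sdeg k.1) a; first by rewrite fa ?mul0r.
rewrite gb ?mulr0 //; have := congr1 sdeg mk; rewrite sdegD => mE.
rewrite mE in mab.
by rewrite -(ltn_add2l a); apply: leq_ltn_trans mab; rewrite leq_add2r.
Qed.

Lemma order_ge_sum n (I : Type) (s : seq I) (f : I -> S) (P : pred I) :
  (forall i, P i -> order_ge n (f i)) -> order_ge n (\sum_(i <- s | P i) f i).
Proof. by move=> fn m mn; rewrite raddf_sum big1 // => i Pi; apply: fn. Qed.

Lemma entry_hommax u : entry F u \in hommax F.
Proof.
apply/asboolP; exists [:: (1, entry F u)]; split; last by rewrite big_seq1 mul1r.
by move=> x; rewrite inE => /eqP -> /=; exists u.1, u.2.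
Qed.

Lemma entry_order u : order_ge 1 (segre (entry F u)).
Proof.
by move=> m; rewrite segre_entry mcoeffX; case: eqP => [<-|//]; rewrite sdeg_bidegree.
Qed.

Lemma hommax_order r : r \in hommax F -> order_ge 1 (segre r).
Proof.
move=> /asboolP [s [sA ->]]; rewrite rmorph_sum big_seq; apply: order_ge_sum => u us.
have [i [j ->]] := sA _ us; rewrite rmorphM; apply: (@order_geM 0 1) => //.
exact: (entry_order (i, j)).
Qed.

Lemma wprod_powideal n L : (n < size L)%N -> wprod F L \in powideal (hommax F) n.+1.
Proof.
move=> nL; rewrite -(cat_take_drop n.+1 L) wprod_cat mulrC idealMr //.
have sz : size (take n.+1 L) = n.+1 by rewrite size_take_min; apply/minn_idPl.
apply/asboolP; exists [:: (1, wprod F (take n.+1 L))].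
split; last by rewrite big_seq1 mul1r.
move=> x; rewrite inE => /eqP -> /=.
exists (fun j : 'I_n.+1 => entry F (nth (0, 0) (take n.+1 L) j)).
split; first by move=> j; apply: entry_hommax.
by rewrite /wprod (big_nth (0, 0)) sz big_mkord.
Qed.

(** A monomial of degree at least n is the product of n entries and of another
    monomial. *)
Lemma mem_powideal n r :
  r \in powideal (hommax F) n.+1 <-> order_ge n.+1 (segre r).
Proof.
split=> [/asboolP [s [sA ->]]|ordr].
  rewrite rmorph_sum big_seq; apply: order_ge_sum => u us.
  have [a [aI ->]] := sA _ us; rewrite rmorphM; apply: (@order_geM 0) => //.
  rewrite rmorph_prod {sA us u s}; elim: n.+1 a aI => [|k IHk] a aI //.
  rewrite big_ord_recl; apply: (@order_geM 1 k); first exact: hommax_order.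
  by apply: IHk => j.
rewrite (segreK r) /linext big_seq; apply: rpred_sum => m.
rewrite mcoeff_msupp => rm; apply: idealMr.
have /marginP[L mL] : balanced m by apply: contraNT rm => /segre_balanced ->.
rewrite -mL chi_margin; apply: wprod_powideal; rewrite -sdeg_margin mL ltnNge.
by apply: contra rm => mn; rewrite ordr.
Qed.

Definition resid (r : R) : F := (segre r)@_0%MM.

Lemma residD r s : resid (r + s) = resid r + resid s.
Proof. by rewrite /resid rmorphD mcoeffD. Qed.
Lemma residM r s : resid (r * s) = resid r * resid s.
Proof. by rewrite /resid !rmorphM. Qed.
Lemma resid_const c : resid (const c) = c.
Proof. by rewrite /resid segre_const mcoeffC eqxx mulr1. Qed.
Lemma resid_hommax r : r \in hommax F -> resid r = 0.
Proof. by move/hommax_order; apply; rewrite sdeg0. Qed.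

Lemma sub_resid r : r - const (resid r) \in hommax F.
Proof.
elim/detring_ind: r => [c|u|r s hr hs|r s hr hs].
- by rewrite resid_const subrr idealr0.
- by rewrite resid_hommax ?entry_hommax // rmorph0 subr0 entry_hommax.
- by rewrite residD rmorphD opprD addrACA rpredD.
rewrite residM rmorphM.
have -> : r * s - const (resid r) * const (resid s) =
  r * (s - const (resid s)) + const (resid s) * (r - const (resid r)) by ring.
by rewrite rpredD // idealMr.
Qed.

Lemma hommaxP r : r \in hommax F <-> resid r = 0.
Proof.
split=> [/resid_hommax //|r0].
by have := sub_resid r; rewrite r0 rmorph0 subr0.
Qed.

End PowersOfMaximalIdeal.

(** * Functionals on monomials *)

Section DualModule.
Variable F : fieldType.
Local Notation R := (detring F).
Local Notation mono := 'X_{1..2 + 3}.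

(** The functionals on the polynomial ring in s and t, given by their values on
    the monomials; the ring acts through its Segre embedding. *)
Definition dual : Type := mono -> F.

HB.instance Definition _ := gen_eqMixin dual.
HB.instance Definition _ := gen_choiceMixin dual.

Definition dual_zero : dual := fun=> 0.
Definition dual_opp (f : dual) : dual := fun m => - f m.
Definition dual_add (f g : dual) : dual := fun m => f m + g m.
Definition dual_scale (r : R) (f : dual) : dual :=
  fun m => linext (@idfun F) (fun n => f (m + n)%MM) (segre r).

Lemma dual_addA : associative dual_add.
Proof. by move=> f g h; apply/funext => m; rewrite /dual_add addrA. Qed.
Lemma dual_addC : commutative dual_add.
Proof. by move=> f g; apply/funext => m; rewrite /dual_add addrC. Qed.
Lemma dual_add0 : left_id dual_zero dual_add.
Proof. by move=> f; apply/funext => m; rewrite /dual_add add0r. Qed.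
Lemma dual_addN : left_inverse dual_zero dual_opp dual_add.
Proof. by move=> f; apply/funext => m; rewrite /dual_add addNr. Qed.

HB.instance Definition _ :=
  GRing.isZmodule.Build dual dual_addA dual_addC dual_add0 dual_addN.

Lemma dual_scaleA a b v : dual_scale a (dual_scale b v) = dual_scale (a * b) v.
Proof.
apply/funext => m; rewrite /dual_scale rmorphM linextM; apply: eq_linext => n _.
by apply: eq_linext => k _; rewrite addmA.
Qed.
Lemma dual_scale1 : left_id 1 dual_scale.
Proof.
by move=> v; apply/funext => m; rewrite /dual_scale rmorph1 linextC mul1r addm0.
Qed.
Lemma dual_scaleDr : right_distributive dual_scale +%R.
Proof. by move=> a u v; apply/funext => m; apply: linextD. Qed.
Lemma dual_scaleDl v : {morph dual_scale^~ v : a b / a + b}.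
Proof. by move=> a b; apply/funext => m; rewrite /dual_scale !rmorphD raddfD. Qed.

HB.instance Definition _ := GRing.Zmodule_isLmodule.Build R dual
  dual_scaleA dual_scale1 dual_scaleDr dual_scaleDl.

Lemma dualD (f g : dual) m : (f + g) m = f m + g m. Proof. by []. Qed.
Lemma dualZ (r : R) (f : dual) m :
  (r *: f) m = linext (@idfun F) (fun n => f (m + n)%MM) (segre r).
Proof. by []. Qed.
Lemma dual_sum (I : Type) (s : seq I) (P : pred I) (f : I -> dual) m :
  (\sum_(i <- s | P i) f i) m = \sum_(i <- s | P i) f i m.
Proof. exact: (big_morph (fun f : dual => f m)). Qed.

Lemma dual_const c (f : dual) m : (const c *: f) m = c * f m.
Proof. by rewrite dualZ segre_const linextC addm0. Qed.
Lemma dual_chi n (f : dual) m : balanced n -> (chi F n *: f) m = f (m + n)%MM.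
Proof. by move=> bn; rewrite dualZ segre_chi // linextX. Qed.
Lemma dual_entry u (f : dual) m : (entry F u *: f) m = f (m + bidegree u)%MM.
Proof. by rewrite dualZ segre_entry linextX. Qed.

Definition delta (m : mono) : dual := fun n => (n == m)%:R.

Lemma dual_delta0 (r : R) m : (r *: delta m) 0%MM = (segre r)@_m.
Proof.
rewrite dualZ [in RHS](mpolyE (segre r)) [RHS]raddf_sum; apply: eq_bigr => n _ /=.
by rewrite mcoeffZ mcoeffX /delta add0m.
Qed.

(** The functionals that will form the injective hull: they vanish in large
    degree and outside the monomials of the ring. *)
Definition trunc (d : nat) (f : dual) : Prop :=
  (forall m, (d <= sdeg m)%N -> f m = 0) /\ (forall m, ~~ balanced m -> f m = 0).

Lemma trunc_le d d' f : (d <= d')%N -> trunc d f -> trunc d' f.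
Proof. by move=> dd' [fd fb]; split=> // m /(leq_trans dd'); apply: fd. Qed.

Lemma trunc0 d : trunc d 0. Proof. by []. Qed.

Lemma truncD d f g : trunc d f -> trunc d g -> trunc d (f + g).
Proof.
move=> [fd fb] [gd gb]; split=> m hm; rewrite dualD; first by rewrite fd ?gd ?addr0.
by rewrite fb ?gb ?addr0.
Qed.

Lemma truncZ d (r : R) f : trunc d f -> trunc d (r *: f).
Proof.
move=> [fd fb]; split=> m hm; rewrite dualZ; apply: linext_eq0 => n.
  by move=> _; rewrite fd // sdegD (leq_trans hm) // leq_addr.
rewrite mcoeff_msupp => rn; rewrite fb // balancedDr //.
by apply: contraNT rn => /segre_balanced ->.
Qed.

Lemma trunc_delta m : balanced m -> trunc (sdeg m).+1 (delta m).
Proof.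
by move=> bm; split=> n hn; rewrite /delta; case: eqP hn => [->|//]; rewrite ?ltnn ?bm.
Qed.

(** A power of the maximal ideal pushes all the exponents out of the support. *)
Lemma trunc_powideal d r f :
  r \in powideal (hommax F) d.+1 -> trunc d.+1 f -> r *: f = 0.
Proof.
move=> /mem_powideal rd [fd _]; apply/funext => m; rewrite dualZ.
apply: linext_eq0 => n; rewrite mcoeff_msupp => rn; apply: fd.
rewrite sdegD (leq_trans _ (leq_addl _ _)) // leqNgt.
by apply: contra rn => /rd ->.
Qed.

Lemma trunc_expand d f : trunc d f ->
  f = \sum_(m : bmultinom (2 + 3) (d + d) | balanced m && (sdeg m < d)%N)
        const (f m) *: delta m.
Proof.
move=> [fd fb]; apply/funext => n; rewrite dual_sum.
have [/andP[bn nd]|nn] := boolP (balanced n && (sdeg n < d)%N).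
  (* The total degree of a balanced monomial is twice its degree in s. *)
  have nD : (mdeg n < d + d)%N by rewrite mdeg_sdeg -(eqP bn); lia.
  pose n' : bmultinom (2 + 3) (d + d) := BMultinom nD.
  rewrite (bigD1 n') ?bn //= dual_const /delta eqxx mulr1.
  rewrite big1 ?addr0 // => m /andP[_ mn]; rewrite dual_const.
  by case: eqP => [nm|]; rewrite ?mulr0 //; case/eqP: mn; apply: val_inj.
rewrite big1 => [|m bm]; last first.
  by rewrite dual_const /delta; case: eqP bm nn => [->->|]; rewrite ?mulr0.
move: nn; rewrite negb_and => /orP[/fb //|]; rewrite -leqNgt; exact: fd.
Qed.

End DualModule.

(** * The socle of the injective hull *)

Lemma scaler_swap (A : comNzRingType) (M : lmodType A) (a b : A) (x : M) :
  a *: (b *: x) = b *: (a *: x).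
Proof. by rewrite !scalerA mulrC. Qed.

Lemma linear_kill (A : comNzRingType) (M N : lmodType A) (h : {linear M -> N}) (r : A) x :
  r *: x = 0 -> r *: h x = 0.
Proof. by move=> rx; rewrite -linearZ rx linear0. Qed.

(** Once the annihilators of the r^n x are constant, from N on, no nonzero
    multiple of r^N x is killed by r, so that r^N x vanishes by hypothesis. *)
Lemma noetherian_nilpotent (A : comNzRingType) (M : lmodType A) (r : A) :
    noetherian A ->
    (forall y : M, y != 0 -> exists s, s *: y != 0 /\ r *: (s *: y) = 0) ->
  forall x : M, exists n, r ^+ n *: x = 0.
Proof.
move=> nA ann x; have [n|n s|N JN] := nA (fun n s => r ^+ n *: (s *: x) = 0).
- split=> [|a u v hu hv]; first by rewrite scale0r scaler0.
  by rewrite scalerDl scalerDr hv addr0 -scalerA [LHS]scaler_swap hu scaler0.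
- by move=> h; rewrite exprS -scalerA h scaler0.
exists N; apply: contrapT => /eqP /ann [s [s0 rs]].
case/eqP: s0; rewrite scaler_swap; apply: (JN N.+1).
by rewrite exprS -scalerA (scaler_swap (r ^+ N)) rs.
Qed.

Section QuotientMap.
Local Open Scope quotient_scope.
Variables (A : comNzRingType) (I : idealr A).

Definition qpi (r : A) : quotmod I := \pi_({ideal_quot I}) r.
Definition qrepr (x : quotmod I) : A := repr (x : {ideal_quot I}).

Lemma qreprK : cancel qrepr qpi.
Proof. by move=> x; rewrite /qpi /qrepr reprK. Qed.
Lemma qpiZ a r : a *: qpi r = qpi (a * r).
Proof.
change (quotmod_scale a (qpi r) = qpi (a * r)).
by rewrite /quotmod_scale /qpi rmorphM.
Qed.
Lemma qpiD r s : qpi (r + s) = qpi r + qpi s.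
Proof. exact: rmorphD. Qed.
Lemma qpi0 : qpi 0 = 0.
Proof. exact: rmorph0. Qed.
Lemma eq_qpi r s : (qpi r == qpi s) = (r - s \in I).
Proof. by rewrite Quotient.idealrBE. Qed.
Lemma qpi_eq0 r : (qpi r == 0) = (r \in I).
Proof. by rewrite -qpi0 eq_qpi subr0. Qed.

End QuotientMap.

Section Cover.
Variable F : fieldType.
Local Notation R := (detring F).
Local Notation pos := ('I_2 * 'I_3)%type.
Local Notation mono := 'X_{1..2 + 3}.
Local Notation k := (quotmod (hommax F)).

Lemma noetherian_detring : noetherian R.
Proof.
have [B [g [nB gc gx]]] := noetherian_adjoin (@const F)
  [seq entry F u | u <- enum {: pos}] (@noetherian_field F).
refine (@noetherian_surj _ _ g _ nB).
elim/detring_ind => [c|u|r s [a <-] [b <-]|r s [a <-] [b <-]].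
- exact: gc.
- by apply: gx; apply/mapP; exists u; rewrite ?mem_enum.
- by exists (a + b); rewrite rmorphD.
- by exists (a * b); rewrite rmorphM.
Qed.

Local Notation residue := (qpi (hommax F)).

Lemma residue_eq0 r : (residue r == 0) = (resid r == 0).
Proof. by rewrite qpi_eq0; apply/idP/eqP => /hommaxP. Qed.

Lemma residue_const r : residue r = residue (const (resid r)).
Proof. by apply/eqP; rewrite eq_qpi sub_resid. Qed.

Lemma hommax_delta0 r : r \in hommax F -> r *: delta F 0%MM = 0.
Proof.
move=> /hommax_order r0; apply: (@trunc_powideal _ 0); first exact/mem_powideal.
by have := trunc_delta F balanced0; rewrite sdeg0.
Qed.

Lemma scale_delta0 r : r *: delta F 0%MM = const (resid r) *: delta F 0%MM.
Proof.
by apply/eqP; rewrite -subr_eq0 -scalerBl hommax_delta0 // sub_resid.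
Qed.

Definition socle (x : k) : dual F := qrepr x *: delta F 0%MM.

Lemma socle_residue r : socle (residue r) = r *: delta F 0%MM.
Proof.
apply/eqP; rewrite -subr_eq0 -scalerBl hommax_delta0 //.
by rewrite -eq_qpi qreprK.
Qed.

Lemma socle_is_linear : linear socle.
Proof.
move=> a x y; rewrite -[x]qreprK -[y]qreprK.
by rewrite qpiZ -qpiD !socle_residue scalerDl scalerA.
Qed.
HB.instance Definition _ := GRing.isLinear.Build R k (dual F) *:%R socle socle_is_linear.

Lemma socle_inj : injective socle.
Proof.
apply: raddf_inj => x; rewrite -[x]qreprK /= socle_residue scale_delta0.
move=> /(congr1 (fun f : dual F => f 0%MM)); rewrite dual_const /delta eqxx mulr1 => r0.
by apply/eqP; rewrite residue_eq0 r0.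
Qed.

Section Hull.
Variables (E : lmodType R) (i : {linear k -> E}) (hullE : injective_hull i).

Lemma hull_essential (x : E) : x != 0 ->
  exists r s, r *: x = i (residue s) /\ i (residue s) != 0.
Proof.
move=> x0; have [_ ess _] := hullE.
have [||y /asboolP [r yE] y0] := ess (fun y => `[< exists r, y = r *: x >]).
- split=> [|a u v]; first by apply/asboolP; exists 0; rewrite scale0r.
  move=> /asboolP [r ->] /asboolP [s ->]; apply/asboolP; exists (a * r + s).
  by rewrite scalerDl scalerA.
- by exists x => //; apply/asboolP; exists 1; rewrite scale1r.
by exists r, (qrepr y); rewrite qreprK -yE.
Qed.

Lemma hommax_residue r s : r \in hommax F -> r *: i (residue s) = 0.
Proof.
move=> rI; apply: linear_kill; apply/eqP; rewrite qpiZ residue_eq0.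
by apply/eqP/hommaxP; rewrite mulrC idealMr.
Qed.

Lemma hommax_kill (x : E) : (forall u, entry F u *: x = 0) ->
  forall r, r *: x = const (resid r) *: x.
Proof.
move=> x0 r; apply/eqP; rewrite -subr_eq0 -scalerBl.
have /asboolP [s [sA ->]] := sub_resid r.
rewrite scaler_suml big_seq big1 // => u us.
by have [a [b ->]] := sA _ us; rewrite -scalerA (x0 (a, b)) scaler0.
Qed.

Lemma const_unscale (c : F) (x : E) : c != 0 -> const c^-1 *: (const c *: x) = x.
Proof. by move=> c0; rewrite scalerA -rmorphM mulVf // rmorph1 scale1r. Qed.

(** The nonzero multiples of x are then scalar multiples of x, and one of them
    lies in the image of the residue field. *)
Lemma hull_socle (x : E) : (forall u, entry F u *: x = 0) ->
  exists c, x = const c *: i (residue 1).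
Proof.
move=> x0; have [->|nx] := eqVneq x 0; first by exists 0; rewrite rmorph0 scale0r.
have [r [s [rx s0]]] := hull_essential nx; rewrite (hommax_kill x0) in rx.
have r0 : resid r != 0.
  by apply: contraNneq s0 => r0; rewrite -rx r0 rmorph0 scale0r.
exists ((resid r)^-1 * resid s).
rewrite rmorphM -scalerA -[LHS](const_unscale _ r0) rx; congr (_ *: _).
by rewrite -linearZ qpiZ mulr1 -residue_const.
Qed.

End Hull.
End Cover.

(** * The injective hull as a module of functionals *)

Section HullStructure.
Variable F : fieldType.
Local Notation R := (detring F).
Local Notation pos := ('I_2 * 'I_3)%type.
Local Notation mono := 'X_{1..2 + 3}.
Local Notation residue := (qpi (hommax F)).
Variables (E : lmodType R) (i : {linear quotmod (hommax F) -> E}).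
Hypothesis hullE : injective_hull i.

Lemma hommax_nilpotent (x : E) r : r \in hommax F -> exists n, r ^+ n *: x = 0.
Proof.
move=> rI; apply: (noetherian_nilpotent (@noetherian_detring F)) => y.
move=> /(hull_essential hullE) [s [t [sy t0]]].
by exists s; rewrite sy hommax_residue.
Qed.

Lemma wprod_count u L :
  wprod F L = entry F u ^+ count_mem u L * wprod F [seq v <- L | v != u].
Proof.
elim: L => [|v L IHL] /=; first by rewrite /wprod !big_nil expr0 mulr1.
rewrite wprod_cons IHL; case: (eqVneq v u) => [->|_] /=.
  by rewrite add1n exprS mulrA.
by rewrite add0n wprod_cons mulrCA.
Qed.

(** Every letter acts nilpotently, and a long word repeats some letter often. *)
Lemma hull_torsion (x : E) : exists n, forall L, (n <= size L)%N -> wprod F L *: x = 0.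
Proof.
have /choice [e eP] : forall u, exists n, entry F u ^+ n *: x = 0.
  by move=> u; apply: hommax_nilpotent; apply: entry_hommax.
exists (\sum_u e u).+1 => L eL.
have [u eu] : exists u, (e u <= count_mem u L)%N.
  apply: contrapT => none; move: eL; rewrite ltnNge => /negP; apply.
  rewrite (_ : size L = \sum_u count_mem u L)%N.
    by apply: leq_sum => u _; rewrite leqNgt; apply/negP => h; apply: none; exists u; apply: ltnW.
  elim: L {none} => [|v L IHL] /=; first by rewrite big1.
  by rewrite big_split /= -IHL (bigD1 v) //= eqxx big1 // => w /negPf wv; rewrite eq_sym wv.
rewrite (wprod_count u) -(subnK eu) exprD mulrAC mulrC.
by rewrite mulrC -scalerA eP scaler0.
Qed.

(** A nonzero truncated functional is moved into the socle by a monomial of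
    largest degree in its support. *)
Lemma cover_inj (g : {linear dual F -> E}) :
    (forall x, g (socle x) = i x) ->
  forall d f, trunc d f -> g f = 0 -> f = 0.
Proof.
move=> gi; elim=> [|d IHd] f [fd fb] gf; first by apply/funext => m; rewrite fd.
apply: (IHd) => //; split=> // m; rewrite leq_eqVlt => /orP[/eqP dm|]; last exact: fd.
have [bm|/fb //] := boolP (balanced m).
have fE : chi F m *: f = const (f m) *: delta F 0%MM.
  apply/funext => n; rewrite dual_chi // dual_const /delta.
  have [->|n0] := eqVneq n 0%MM; first by rewrite add0m mulr1.
  rewrite mulr0; have [bn|bn] := boolP (balanced n); last by rewrite fb // balancedDr.
  rewrite fd // sdegD -dm -{1}[d]add0n ltn_add2r lt0n.
  by apply: contra n0 => /eqP /(balanced_sdeg0 bn) ->.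
have : g (chi F m *: f) = 0 by rewrite linearZ /= gf scaler0.
rewrite fE -[const _ *: _]/(_ *: _) => g0.
have [inj_i _ _] := hullE; apply/eqP; rewrite -(resid_const (f m)) -residue_eq0.
by apply/eqP/inj_i; rewrite linear0 -gi socle_residue.
Qed.

(** By induction on the order of torsion, each x_ij x is the image of a
    functional h_ij. These are the translates of a single functional f, whose
    value at the product of x_ij and m is the value of h_ij at m, and the
    difference of x and of the image of f lies in the socle. *)
Lemma cover_surj (g : {linear dual F -> E}) :
    (forall x, g (socle x) = i x) ->
  forall x, exists d f, trunc d f /\ g f = x.
Proof.
move=> gi x; have [n nx] := hull_torsion x.
elim: n x nx => [|n IHn] x nx.
  exists 0%N, 0; split; first exact: trunc0.
  by rewrite linear0 -[LHS](nx [::]) // /wprod big_nil scale1r.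
have /choice [h hP] : forall u, exists h, (exists d, trunc d h) /\ g h = entry F u *: x.
  move=> u; have [|d [h [dh gh]]] := IHn (entry F u *: x); last first.
    by exists h; split=> //; exists d.
  by move=> L nL; rewrite scalerA mulrC -wprod_cons nx.
have gI d f f' : trunc d f -> trunc d f' -> g f = g f' -> f = f'.
  move=> df df' ff'; apply/eqP; rewrite -subr_eq0; apply/eqP.
  apply: (cover_inj gi (d := d)); last by rewrite linearB /= ff' subrr.
  by apply: truncD => //; rewrite -scaleN1r; apply: truncZ.
have hE u L v L' : margin (u :: L) = margin (v :: L') -> h u (margin L) = h v (margin L').
  move=> uv; have [[[d du] gu] [[d' dv] gv]] := (hP u, hP v).
  rewrite -[margin L]add0m -[margin L']add0m -!dual_chi ?balanced_margin //.
  congr ((_ : dual F) _); rewrite !chi_margin; apply: (gI (maxn d d')).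
  - by apply: truncZ; apply: trunc_le du; apply: leq_maxl.
  - by apply: truncZ; apply: trunc_le dv; apply: leq_maxr.
  rewrite !linearZ /= gu gv !scalerA mulrC -wprod_cons (wprod_margin F uv).
  by rewrite mulrC -wprod_cons.
pose f : dual F := fun m =>
  if pselect (exists L, margin (L.1 :: L.2) = m) is left ex
  then h (projT1 (cid ex)).1 (margin (projT1 (cid ex)).2) else 0.
have fE u L : f (margin (u :: L)) = h u (margin L).
  rewrite /f; case: pselect => [ex|[]]; last by exists (u, L).
  by case: cid => L' /= /hE.
have f0 m : ~~ balanced m -> f m = 0.
  move=> bm; rewrite /f; case: pselect => // -[L mL]; case/negP: bm.
  by rewrite -mL balanced_margin.
have ft : trunc n.+1 f.
  split=> // m nm; have [|/f0 //] := boolP (balanced m).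
  move=> /marginP [[|u L] mE]; first by move: nm; rewrite -mE sdeg_margin.
  rewrite -mE fE; have [[d du] gu] := hP u.
  rewrite -[margin L]add0m -dual_chi ?balanced_margin // chi_margin.
  rewrite (cover_inj gi (truncZ _ du)) // linearZ /= gu scalerA mulrC -wprod_cons.
  by apply: nx; rewrite -sdeg_margin mE.
have hf u : entry F u *: f = h u.
  apply/funext => m; rewrite dual_entry.
  have [/marginP [L <-]|bm] := boolP (balanced m); first by rewrite addmC -margin_cons fE.
  have [[d [_ ->]] // _] := hP u.
  by rewrite f0 // balancedDr // balanced_bidegree.
have [u|c cE] := hull_socle hullE (x := x - g f).
  by rewrite scalerBr -linearZ /= hf; have [_ ->] := hP u; rewrite subrr.
exists n.+1, (f + const c *: delta F 0%MM); split.
  apply: truncD => //; apply: truncZ; apply: (@trunc_le _ 1) => //.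
  by have := trunc_delta F balanced0; rewrite sdeg0.
rewrite linearD linearZ /= -[delta _ _]scale1r -socle_residue gi -cE.
by rewrite addrC subrK.
Qed.

(** Injectivity of E extends to all the functionals the embedding of the residue
    field in E, seen as a map defined on the functionals supported at 1. *)
Lemma hull_cover : exists g : {linear dual F -> E},
  (forall d f, trunc d f -> g f = 0 -> f = 0) /\
  (forall x, exists d f, trunc d f /\ g f = x).
Proof.
have [_ _ injE] := hullE.
have [g gi] := injE _ _ (socle (F:=F) : {linear _ -> _}) i (@socle_inj F).
by exists g; split; [apply: cover_inj | apply: cover_surj].
Qed.
End HullStructure.

(** * Coordinates on the injective hull *)

Section Representatives.
Local Open Scope quotient_scope.
Variables (A : comNzRingType) (I : idealr A).
Implicit Types (a b : completion I) (r s : A).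

Definition represents a n r : Prop := cval a n = \pi r.

Lemma representsP a n : exists r, represents a n r.
Proof. by have [r [? _]] := cvalP a n; exists r. Qed.

Lemma represents_eq a n r s :
  represents a n r -> represents a n s -> r - s \in powideal I n.+1.
Proof. by rewrite /represents Quotient.idealrBE => -> ->. Qed.

Lemma represents_sub a n r s :
  represents a n r -> r - s \in powideal I n.+1 -> represents a n s.
Proof. by rewrite /represents Quotient.idealrBE => -> /eqP. Qed.

Lemma powideal_succ n : {subset powideal I n.+2 <= powideal I n.+1}.
Proof.
apply: genideal_sub => _ [c [cI ->]]; rewrite big_ord_recl idealMr //.
apply/asboolP; exists [:: (1, \prod_j c (lift ord0 j))].
split; last by rewrite big_seq1 mul1r.
by move=> u; rewrite inE => /eqP -> /=; exists (fun j => c (lift ord0 j)).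
Qed.

Lemma represents_le a m n r : (m <= n)%N -> represents a n r -> represents a m r.
Proof.
elim: n => [|n IHn]; first by rewrite leqn0 => /eqP ->.
rewrite leq_eqVlt => /orP[/eqP -> //|mn] ar; apply: IHn => //.
have [s [sn sn1]] := cvalP a n; apply: (represents_sub sn).
by apply: powideal_succ; apply: represents_eq ar.
Qed.

Lemma representsD a b n r s :
  represents a n r -> represents b n s -> represents (a + b) n (r + s).
Proof. by rewrite /represents /= rmorphD => -> ->. Qed.
Lemma representsN a n r : represents a n r -> represents (- a) n (- r).
Proof. by rewrite /represents /= rmorphN => ->. Qed.
Lemma representsM a b n r s :
  represents a n r -> represents b n s -> represents (a * b) n (r * s).
Proof. by rewrite /represents /= rmorphM => -> ->. Qed.
Lemma represents_to r n : represents (to_completion I r) n r.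
Proof. by []. Qed.

Lemma completion_ext a b :
  (forall n, exists2 r, represents a n r & represents b n r) -> a = b.
Proof. by move=> ab; apply: cval_inj => n; have [r -> ->] := ab n. Qed.

Lemma completion_lim (r : nat -> A) :
  (forall n, r n.+1 - r n \in powideal I n.+1) ->
  exists a, forall n, represents a n (r n).
Proof.
move=> rn; have cP n : exists s : A,
    (\pi_({ideal_quot (powideal I n.+1)}) (r n) = \pi s) /\
    (\pi_({ideal_quot (powideal I n.+2)}) (r n.+1) = \pi s).
  exists (r n.+1); split=> //; apply/eqP; rewrite -Quotient.idealrBE.
  by rewrite -opprB rpredN.
by exists (@Completion _ I (fun n => \pi_({ideal_quot (powideal I n.+1)}) (r n)) cP).
Qed.

End Representatives.

Section Coordinates.
Variable F : fieldType.
Local Notation R := (detring F).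
Local Notation mono := 'X_{1..2 + 3}.

Definition is_cover (E : lmodType R) (g : {linear dual F -> E}) : Prop :=
  (forall d f, trunc d f -> g f = 0 -> f = 0) /\
  (forall x, exists d f, trunc d f /\ g f = x).

Variables (E : lmodType R) (g : {linear dual F -> E}) (gC : is_cover g).

Lemma coord_subproof x : exists f, (exists d, trunc d f) /\ g f = x.
Proof. by have [d [f [df gf]]] := proj2 gC x; exists f; split=> //; exists d. Qed.

Definition coords (x : E) : dual F := projT1 (cid (coord_subproof x)).

Lemma coordK x : g (coords x) = x.
Proof. by rewrite /coords; case: cid => f [_ /=]. Qed.

Lemma coord_trunc x : exists d, trunc d (coords x).
Proof. by rewrite /coords; case: cid => f [/=]. Qed.

Lemma truncB d d' (f f' : dual F) : trunc d f -> trunc d' f' -> exists d'', trunc d'' (f - f').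
Proof.
move=> df df'; exists (maxn d d'); apply: truncD.
  by apply: trunc_le df; apply: leq_maxl.
by rewrite -scaleN1r; apply: truncZ; apply: trunc_le df'; apply: leq_maxr.
Qed.

Lemma coverK d f : trunc d f -> coords (g f) = f.
Proof.
move=> df; have [d' df'] := coord_trunc (g f); apply/eqP; rewrite -subr_eq0; apply/eqP.
have [d'' dd] := truncB df' df.
by apply: (proj1 gC) dd _; rewrite linearB /= coordK subrr.
Qed.

Lemma coord_is_linear : linear coords.
Proof.
move=> r x y; have [[d dx] [d' dy]] := (coord_trunc x, coord_trunc y).
rewrite -{1}[x]coordK -{1}[y]coordK -linearZ -linearD (@coverK (maxn d d')) //.
apply: truncD; last by apply: trunc_le dy; apply: leq_maxr.
by apply: truncZ; apply: trunc_le dx; apply: leq_maxl.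
Qed.
HB.instance Definition _ := GRing.isLinear.Build R E (dual F) *:%R coords coord_is_linear.

Lemma coord_expand d x : trunc d (coords x) ->
  x = \sum_(m : bmultinom (2 + 3) (d + d) | balanced m && (sdeg m < d)%N)
        const (coords x m) *: g (delta F m).
Proof.
move=> dx; rewrite -[LHS]coordK {1}(trunc_expand dx) linear_sum.
by apply: eq_bigr => m _; rewrite linearZ.
Qed.

Lemma coord_delta m : balanced m -> coords (g (delta F m)) = delta F m.
Proof. by move=> bm; apply: (coverK (trunc_delta F bm)). Qed.

Lemma powideal_kill n r x :
  r \in powideal (hommax F) n.+1 -> trunc n.+1 (coords x) -> r *: x = 0.
Proof.
move=> rI dx; rewrite -[x]coordK; apply: linear_kill; exact: trunc_powideal rI dx.
Qed.

End Coordinates.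

(** * Endomorphisms of the injective hull *)

Section DegreeZero.
Variables (p : nat) (A B : comNzRingType) (M : lmodType A) (act : B -> M -> M).
Hypothesis actDr : forall b, {morph act b : x y / x + y}.
Hypothesis actZ : forall b r x, act b (r *: x) = r *: act b x.
Hypothesis actB : forall a b x, act (a - b) x = act a x - act b x.
Hypothesis act1 : forall x, act 1 x = x.
Hypothesis actM : forall a b x, act (a * b) x = act a (act b x).

Definition degree0_fun (b : B) (e : nat) : M -> M :=
  if e is 0%N then act b else fun=> 0.

Lemma degree0_funP b e : frobenius_op p e (degree0_fun b e).
Proof.
case: e => [|e]; last exact: fzeroP.
by split=> [x y|r x]; rewrite /degree0_fun ?actDr // expn0 expr1 actZ.
Qed.

Lemma degree0_fun_fin b : exists N, forall e, (N <= e)%N -> forall x, degree0_fun b e x = 0.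
Proof. by exists 1%N => -[]. Qed.

Definition degree0_op (b : B) : frobring p M :=
  Frobring (degree0_funP b) (degree0_fun_fin b).

Lemma degree0_op_is_zmod_morphism : zmod_morphism degree0_op.
Proof. by move=> a b; apply: fval_inj => -[|e] x /=; rewrite ?actB ?subrr. Qed.

Lemma degree0_op_is_monoid_morphism : monoid_morphism degree0_op.
Proof.
split=> [|a b]; apply: fval_inj => e x /=; first by case: e => //=.
rewrite /fmul_fun big_ord_recl big1 ?addr0 => [|j _] //=.
by rewrite subn0; case: e => [|e] /=; rewrite ?actM // -(scale0r 0) actZ !scale0r.
Qed.

HB.instance Definition _ := GRing.isZmodMorphism.Build B (frobring p M)
  degree0_op degree0_op_is_zmod_morphism.
HB.instance Definition _ := GRing.isMonoidMorphism.Build B (frobring p M)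
  degree0_op degree0_op_is_monoid_morphism.

(** A ring acting faithfully by all the endomorphisms is the ring of
    operators of degree zero. *)
Lemma degree0_isom :
  (forall a b, (forall x, act a x = act b x) -> a = b) ->
  (forall phi : M -> M, {morph phi : x y / x + y} ->
     (forall r x, phi (r *: x) = r *: phi x) -> exists b, forall x, phi x = act b x) ->
  exists theta : {rmorphism B -> frobring p M},
   [/\ injective theta,
       forall x, in_degree0 x <-> exists b, theta b = x &
       forall b x, fval (theta b) 0 x = act b x].
Proof.
move=> faithful full; exists (degree0_op : {rmorphism _ -> _}); split=> [a b ab|x|//].
  by apply: faithful => x; have := congr1 (fun y => fval y 0 x) ab.
split=> [x0|[a <-] [|e]] //.
have [||b bP] := full (fval x 0); first exact: fvalD.
  by move=> r y; rewrite fvalZ expn0 expr1.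
by exists b; apply: fval_inj => -[|e] y /=; rewrite ?bP ?x0.
Qed.

End DegreeZero.

Section Matlis.
Variable F : fieldType.
Local Notation R := (detring F).
Local Notation mono := 'X_{1..2 + 3}.
Local Notation Rhat := (completion (hommax F)).
Variables (E : lmodType R) (g : {linear dual F -> E}) (gC : is_cover g).
Local Notation coords := (coords gC).

(** A component of large index determines the action, since a power of the
    maximal ideal kills x. *)
Definition compl_act (a : Rhat) (x : E) : E :=
  projT1 (cid (representsP a (projT1 (cid (coord_trunc gC x))))) *: x.

Lemma compl_actE a x n r : trunc n.+1 (coords x) -> represents a n r ->
  compl_act a x = r *: x.
Proof.
rewrite /compl_act; case: cid => d /= /(trunc_le (leqnSn d)) xd.
case: cid => s /= as_ xn ar; have [t at_] := representsP a (maxn n d).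
have -> : r *: x = t *: x.
  apply/eqP; rewrite -subr_eq0 -scalerBl (powideal_kill _ xn) //.
  by apply: represents_eq ar _; apply: represents_le at_; apply: leq_maxl.
apply/eqP; rewrite -subr_eq0 -scalerBl (powideal_kill _ xd) //.
by apply: represents_eq as_ _; apply: represents_le at_; apply: leq_maxr.
Qed.

Lemma common_trunc x y : exists n, trunc n.+1 (coords x) /\ trunc n.+1 (coords y).
Proof.
have [[d dx] [d' dy]] := (coord_trunc gC x, coord_trunc gC y).
exists (maxn d d'); split.
  by apply: trunc_le dx; rewrite ltnW // ltnS leq_maxl.
by apply: trunc_le dy; rewrite ltnW // ltnS leq_maxr.
Qed.

Lemma compl_actDr a x y : compl_act a (x + y) = compl_act a x + compl_act a y.
Proof.
have [n [nx ny]] := common_trunc x y; have [r ar] := representsP a n.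
have nxy : trunc n.+1 (coords (x + y)) by rewrite linearD; apply: truncD.
rewrite (compl_actE nxy ar) (compl_actE nx ar) (compl_actE ny ar).
exact: scalerDr.
Qed.

Lemma compl_actZ a r x : compl_act a (r *: x) = r *: compl_act a x.
Proof.
have [n [nx _]] := common_trunc x x; have [s ar] := representsP a n.
have nrx : trunc n.+1 (coords (r *: x)) by rewrite linearZ; apply: truncZ.
by rewrite (compl_actE nrx ar) (compl_actE nx ar) scaler_swap.
Qed.

Lemma compl_actDl a b x : compl_act (a + b) x = compl_act a x + compl_act b x.
Proof.
have [n [nx _]] := common_trunc x x.
have [[r ar] [s bs]] := (representsP a n, representsP b n).
by rewrite (compl_actE nx (representsD ar bs)) (compl_actE nx ar) (compl_actE nx bs) scalerDl.
Qed.

Lemma compl_actN a x : compl_act (- a) x = - compl_act a x.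
Proof.
have [n [nx _]] := common_trunc x x; have [r ar] := representsP a n.
by rewrite (compl_actE nx (representsN ar)) (compl_actE nx ar) scaleNr.
Qed.

Lemma compl_actM a b x : compl_act (a * b) x = compl_act a (compl_act b x).
Proof.
have [n [nx _]] := common_trunc x x.
have [[r ar] [s bs]] := (representsP a n, representsP b n).
rewrite (compl_actE nx (representsM ar bs)) (compl_actE nx bs) compl_actZ.
by rewrite (compl_actE nx ar) scalerA mulrC.
Qed.

Lemma compl_act_to r x : compl_act (to_completion (hommax F) r) x = r *: x.
Proof.
by have [n [nx _]] := common_trunc x x; rewrite (compl_actE nx (represents_to _ r n)).
Qed.

(** The functional dual to a monomial reads the coefficient of that monomial in
    a representative. *)
Lemma compl_act_inj a b : (forall x, compl_act a x = compl_act b x) -> a = b.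
Proof.
move=> ab; apply: completion_ext => n.
have [[r ar] [s bs]] := (representsP a n, representsP b n).
exists r => //; apply: (represents_sub bs); apply/mem_powideal => m mn.
have [bm|/segre_balanced -> //] := boolP (balanced m).
have dm : trunc n.+1 (coords (g (delta F m))).
  by rewrite coord_delta //; apply: trunc_le (trunc_delta F bm).
have /eqP := ab (g (delta F m)); rewrite (compl_actE dm ar) (compl_actE dm bs).
rewrite eq_sym -subr_eq0 -scalerBl -linearZ => /eqP.
move=> /(proj1 gC n.+1); rewrite -dual_delta0 => -> //.
by apply: truncZ; apply: trunc_le (trunc_delta F bm).
Qed.

Section EndomorphismAsSeries.
Variable phi : E -> E.
Hypothesis phiD : {morph phi : x y / x + y}.
Hypothesis phiZ : forall r x, phi (r *: x) = r *: phi x.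

(** The coefficients of the series by which the endomorphism acts. *)
Definition symbol (m : mono) : F := coords (phi (g (delta F m))) 0%MM.
Definition symbol_trunc (n : nat) : R :=
  \sum_(m : bmultinom (2 + 3) (n.+1 + n.+1) | balanced m && (sdeg m < n.+1)%N)
    const (symbol m) * chi F m.

Lemma segre_symbol_trunc n m :
  (segre (symbol_trunc n))@_m =
    if balanced m && (sdeg m < n.+1)%N then symbol m else 0.
Proof.
rewrite rmorph_sum raddf_sum /=; case: ifP => bm.
  have mD : (mdeg m < n.+1 + n.+1)%N.
    by case/andP: bm => /eqP bm mn; rewrite mdeg_sdeg -bm; lia.
  pose m' : bmultinom (2 + 3) (n.+1 + n.+1) := BMultinom mD.
  rewrite (bigD1 m') //= big1 ?addr0 => [|k /andP[/andP[bk _] km]].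
    rewrite rmorphM /= segre_const segre_chi; last by case/andP: bm.
    by rewrite mcoeffCM mcoeffX eqxx mulr1.
  rewrite rmorphM /= segre_const segre_chi // mcoeffCM mcoeffX.
  by case: eqP => [km'|]; rewrite ?mulr0 //; case/eqP: km; apply: val_inj.
rewrite big1 // => k bk; rewrite rmorphM /= segre_const segre_chi; last by case/andP: bk.
rewrite mcoeffCM mcoeffX; case: eqP => [km|]; rewrite ?mulr0 //.
by rewrite -km bk in bm.
Qed.

Lemma phi0 : phi 0 = 0.
Proof. by rewrite -(scale0r 0) phiZ !scale0r. Qed.

(** By linearity the coordinate of phi x at m is the coordinate at 1 of the
    image under phi of the multiple of x by the monomial m; so it suffices to
    compare coordinates at 1. *)
Lemma endo_compl_act : exists a, forall x, phi x = compl_act a x.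
Proof.
have [|a aP] := @completion_lim _ (hommax F) symbol_trunc.
  move=> n; apply/mem_powideal => m mn; rewrite rmorphB mcoeffB /=.
  rewrite !segre_symbol_trunc mn (leq_trans mn) ?leqnSn //.
  by case: balanced; rewrite subrr.
exists a => x; have [n [nx _]] := common_trunc x x.
rewrite (compl_actE nx (aP n)).
have at0 y : trunc n.+1 (coords y) ->
    coords (phi y) 0%MM = coords (symbol_trunc n *: y) 0%MM.
  move=> /(coord_expand) {1 2}->; rewrite scaler_sumr !linear_sum /= !dual_sum.
  rewrite (big_morph phi phiD phi0) linear_sum dual_sum.
  apply: eq_bigr => m bm; rewrite phiZ linearZ /= dual_const scaler_swap linearZ /= dual_const.
  congr (_ * _); rewrite linearZ /= coord_delta; last by case/andP: bm.
  by rewrite dual_delta0 segre_symbol_trunc bm.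
rewrite -[phi x](coordK gC) -[RHS](coordK gC); congr (g _); apply/funext => m.
have [bm|bm] := boolP (balanced m); last first.
  have [_ [_ ->] //] := coord_trunc gC (phi x).
  by have [_ [_ ->]] := coord_trunc gC (symbol_trunc n *: x).
have translate y : coords y m = coords (chi F m *: y) 0%MM.
  by rewrite linearZ /= dual_chi // add0m.
rewrite !translate -phiZ at0; first by rewrite scaler_swap.
by rewrite linearZ; apply: truncZ.
Qed.

End EndomorphismAsSeries.

Lemma matlis (p : nat) :
  exists theta : {rmorphism Rhat -> frobring p E},
   [/\ injective theta,
       forall x, in_degree0 x <-> exists a, theta a = x &
       forall r m, fval (theta (to_completion (hommax F) r)) 0 m = r *: m].
Proof.
have [||||| | |theta [inj onto thetaE]] := @degree0_isom p _ Rhat E compl_act.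
- exact: compl_actDr.
- exact: compl_actZ.
- by move=> a b x; rewrite compl_actDl compl_actN.
- by move=> x; rewrite [LHS](compl_act_to 1) scale1r.
- exact: compl_actM.
- exact: compl_act_inj.
- exact: endo_compl_act.
exists theta; split=> // r m; rewrite thetaE; exact: compl_act_to.
Qed.

End Matlis.

(** * Decomposable Frobenius operators *)

Section Decomposable.
Variables (p : nat) (A : comNzRingType) (M : lmodType A).
Implicit Types (e : nat) (phi psi : M -> M).

(** The sums of products of two operators whose degrees are positive and add up
    to e. *)
Inductive decomposable e : (M -> M) -> Prop :=
| Decomposable0 : decomposable e (fun=> 0)
| DecomposableD phi i alpha beta : decomposable e phi -> (0 < i < e)%N ->
    frobenius_op p i alpha -> frobenius_op p (e - i) beta ->
    decomposable e (fun m => phi m + alpha (beta m)).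

Lemma decomposable_add e phi psi : decomposable e phi -> decomposable e psi ->
  decomposable e (fun m => phi m + psi m).
Proof.
move=> dphi; elim=> [|psi' i alpha beta _ IH ie ha hb].
  by rewrite (_ : (fun m => _) = phi) //; apply/funext => m; rewrite addr0.
rewrite (_ : (fun m => _) = (fun m => (phi m + psi' m) + alpha (beta m))).
  exact: DecomposableD IH ie ha hb.
by apply/funext => m; rewrite addrA.
Qed.

Lemma frobenius_op0 e phi : frobenius_op p e phi -> phi 0 = 0.
Proof. by case=> phiD _; apply: (@addrI _ (phi 0)); rewrite -phiD !addr0. Qed.

Lemma frobenius_op_kill e phi (N : lmodType A) (h : {linear N -> M}) (r : A) x :
  frobenius_op p e phi -> r *: x = 0 -> r ^+ (p ^ e) *: phi (h x) = 0.
Proof.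
move=> hphi rx; rewrite -(proj2 hphi) linear_kill //; exact: frobenius_op0 hphi.
Qed.

Lemma frobenius_op_comp e e' phi psi : frobenius_op p e phi ->
  frobenius_op p e' psi -> frobenius_op p (e + e') (fun m => phi (psi m)).
Proof.
move=> [phiD phiZ] [psiD psiZ]; split=> [x y|r x]; first by rewrite psiD phiD.
by rewrite psiZ phiZ -exprM expnD mulnC.
Qed.

Lemma decomposable_compl e phi psi : frobenius_op p 0 psi -> decomposable e phi ->
  decomposable e (fun m => psi (phi m)).
Proof.
move=> hpsi; elim=> [|phi' i alpha beta _ IH ie ha hb].
  by rewrite (frobenius_op0 hpsi); apply: Decomposable0.
rewrite (_ : (fun m => _) = (fun m => psi (phi' m) + psi (alpha (beta m)))).
  exact: (DecomposableD IH ie (frobenius_op_comp hpsi ha) hb).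
by apply/funext => m; rewrite (proj1 hpsi).
Qed.

Lemma decomposable_compr e phi psi : frobenius_op p 0 psi -> decomposable e phi ->
  decomposable e (fun m => phi (psi m)).
Proof.
move=> hpsi; elim=> [|phi' i alpha beta _ IH ie ha hb]; first exact: Decomposable0.
apply: (DecomposableD IH ie ha (beta := fun m => beta (psi m))).
by rewrite -[(e - i)%N]addn0; apply: frobenius_op_comp.
Qed.

Lemma decomposable_sum e n (phi : 'I_n -> M -> M) :
  (forall j, decomposable e (phi j)) -> decomposable e (fun m => \sum_j phi j m).
Proof.
elim: n phi => [|n IHn] phi dphi.
  rewrite (_ : (fun m => _) = (fun=> 0)); first exact: Decomposable0.
  by apply/funext => m; rewrite big_ord0.
rewrite (_ : (fun m => _) =
    (fun m => phi ord0 m + \sum_j phi (lift ord0 j) m)); last first.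
  by apply/funext => m; rewrite big_ord_recl.
by apply: decomposable_add => //; apply: IHn.
Qed.

(** In degree e > N, a product of two families is a sum of compositions of
    components: either both have positive degree, or one has degree zero and
    the other is decomposable. *)
Lemma decomposable_subring N :
  subring_closed (fun x : frobring p M =>
    `[< forall e, (N < e)%N -> decomposable e (fval x e) >]).
Proof.
have neg_op : frobenius_op p 0 (fun m : M => - m).
  by split=> [x y|r x]; rewrite ?opprD // expn0 expr1 scalerN.
split=> [|x y /asboolP dx /asboolP dy|x y /asboolP dx /asboolP dy]; apply/asboolP => e Ne.
- case: e Ne => // e _; exact: Decomposable0.
- apply: decomposable_add; first exact: dx.
  by apply: (decomposable_compl neg_op); apply: dy.
apply: (@decomposable_sum e e.+1 (fun i m => fval x i (fval y (e - i) m))) => i.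
have [i0|i0] := posnP (i : nat).
  rewrite i0 subn0; apply: decomposable_compl (dy e Ne); exact: fvalP.
have [ie|ei] := ltnP i e.
  rewrite (_ : (fun m => _) = (fun m => 0 + fval x i (fval y (e - i) m))).
    apply: (@DecomposableD e (fun=> 0) i (fval x i)); first exact: Decomposable0.
    - by apply/andP.
    - exact: fvalP.
    exact: fvalP.
  by apply/funext => m; rewrite add0r.
have -> : (i : nat) = e by apply/eqP; rewrite eqn_leq ei -ltnS ltn_ord.
rewrite subnn; apply: decomposable_compr (dx e Ne); exact: fvalP.
Qed.

Lemma homogeneous_fin e phi : frobenius_op p e phi ->
  exists x : frobring p M, fval x e = phi.
Proof.
move=> hphi; pose f e' := if e' == e then phi else fun=> 0.
have fP e' : frobenius_op p e' (f e').
  by rewrite /f; case: eqP => [->|_] //; apply: fzeroP.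
have ffin : exists N, forall e', (N <= e')%N -> forall m, f e' m = 0.
  by exists e.+1 => e' /gtn_eqF; rewrite /f => ->.
by exists (Frobring fP ffin); rewrite /= /f eqxx.
Qed.

(** Beyond the degrees of the generators, the subring of the previous lemma
    contains everything. *)
Lemma finitely_generated_decomposable : finitely_generated_over_degree0 p M ->
  exists N, forall e phi, (N < e)%N -> frobenius_op p e phi -> decomposable e phi.
Proof.
move=> [s gen].
have [N NP] : exists N, forall x, x \in s -> forall e, (N <= e)%N ->
    forall m, fval x e m = 0.
  elim: s {gen} => [|x s [N NP]]; first by exists 0%N.
  have [N' N'P] := ffin x; exists (maxn N N') => y; rewrite inE => ys e.
  rewrite geq_max => /andP[Ne N'e]; case/orP: ys => [/eqP ->|ys]; first exact: N'P.
  exact: NP.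
exists N => e phi Ne /homogeneous_fin [x <-].
have zero_dec y e' : (forall m, fval y e' m = 0) -> decomposable e' (fval y e').
  move=> y0; rewrite (_ : fval y e' = fun=> 0); first exact: Decomposable0.
  by apply/funext => m.
pose S : {pred frobring p M} := fun y =>
  `[< forall e', (N < e')%N -> decomposable e' (fval y e') >].
suff /asboolP Sx : x \in S by apply: Sx.
apply: gen; first exact: decomposable_subring.
  move=> y y0; apply/asboolP => e' Ne'; apply: zero_dec; apply: y0.
  exact: leq_ltn_trans Ne'.
move=> y ys; apply/asboolP => e' Ne'; apply: zero_dec => m.
exact: NP ys _ (ltnW Ne') m.
Qed.

End Decomposable.

(** * The coefficients of a Frobenius operator *)

Section OperatorCoefficients.
Variables (p : nat) (F : fieldType).
Local Notation R := (detring F).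
Local Notation pos := ('I_2 * 'I_3)%type.
Local Notation mono := 'X_{1..2 + 3}.
Variables (E : lmodType R) (g : {linear dual F -> E}) (gC : is_cover g).
Local Notation coords := (coords gC).

Lemma dual_entryX u n (f : dual F) m :
  (entry F u ^+ n *: f) m = f (m + bidegree u *+ n)%MM.
Proof.
elim: n m => [|n IHn] m; first by rewrite expr0 scale1r mulm0n addm0.
by rewrite exprS -scalerA dual_entry IHn mulmS addmA.
Qed.

Lemma exists_other n (k : 'I_n.+2) : exists k', k' != k.
Proof.
have [->|k0] := eqVneq k ord0; first by exists ord_max.
by exists ord0; rewrite eq_sym.
Qed.

(** The entries u and v differ in one index, so that replacing u by v trades
    the variable k for another one of the same group. *)
Lemma exists_trade (k : 'I_(2 + 3)) : exists u v : pos,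
  [/\ bidegree u k = 1%N, bidegree v k = 0%N &
      forall l, l != k -> (bidegree u l <= bidegree v l)%N].
Proof.
case: (split_ordP k) => [i|j] ->.
  have [i' /negPf i'i] := exists_other i; exists (i, 0), (i', 0).
  split; rewrite ?bidegree_l /= ?eqxx ?i'i // => l.
  case: (split_ordP l) => [l'|l'] ->; last by rewrite !bidegree_r.
  by rewrite eq_lshift bidegree_l eq_sym => /negPf ->.
have [j' /negPf j'j] := exists_other j; exists (0, j), (0, j').
split; rewrite ?bidegree_r /= ?eqxx ?j'j // => l.
case: (split_ordP l) => [l'|l'] ->; first by rewrite !bidegree_l.
by rewrite eq_rshift bidegree_r eq_sym => /negPf ->.
Qed.

(** The dual of m is v^n times the dual of M = m + n v, so its image is v^(nq)
    times the image of the dual of M. As soon as n exceeds the exponent of m at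
    k, the dual of M is killed by u^n, and its image by u^(nq). If the exponent
    of m' at k were at least q n, the coefficient sought would be a coefficient
    of that zero multiple. *)
Lemma operator_support e (phi : E -> E) m m' :
  frobenius_op p e phi -> balanced m -> coords (phi (g (delta F m))) m' != 0 ->
  forall k, (m' k < p ^ e * (m k).+1)%N.
Proof.
move=> hphi bm nz k; rewrite ltnNge; apply: contra nz => km'; apply/eqP.
have [_ phiZ] := hphi.
have [u [v [uk vk uv]]] := exists_trade k.
set q := (p ^ e)%N in km' phiZ *; pose n := (m k).+1.
pose M := (m + bidegree v *+ n)%MM.
have vM : entry F v ^+ n *: delta F M = delta F m.
  by apply/funext => l; rewrite dual_entryX /delta eqm_add2r.
have uM : entry F u ^+ n *: delta F M = 0.
  apply/funext => l; rewrite dual_entryX /delta; case: eqP => // /(congr1 (fun x : mono => x k)).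
  by rewrite !mnmDE !mulmnE uk vk /n; lia.
rewrite -vM linearZ /= phiZ linearZ /= -exprM dual_entryX.
have le_u : (bidegree u *+ (n * q) <= m' + bidegree v *+ (n * q))%MM.
  apply/mnm_lepP => l; rewrite mnmDE !mulmnE; have [->|lk] := eqVneq l k.
    by rewrite uk vk mul0n addn0 mul1n mulnC.
  by rewrite (leq_trans _ (leq_addl _ _)) // leq_mul2r uv // orbT.
rewrite -(submK le_u) -dual_entryX exprM.
have -> : entry F u ^+ n ^+ q *: coords (phi (g (delta F M))) = 0; last by [].
apply: linear_kill; exact: frobenius_op_kill hphi uM.
Qed.

(** The intermediate monomial m is one through which the coefficient passes:
    beta maps the socle to a finite sum of multiples of duals. *)
Lemma product_support i j (alpha beta : E -> E) (m' : mono) :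
  frobenius_op p i alpha -> frobenius_op p j beta -> (0 < p)%N ->
  coords (alpha (beta (g (delta F 0%MM)))) m' != 0 ->
  exists m : mono, [/\ balanced m, forall k, (m k < p ^ j)%N &
                       forall k, (m' k < p ^ i * (m k).+1)%N].
Proof.
move=> ha hb p0 nz; set y := beta _ in nz; have [d dy] := coord_trunc gC y.
have [alphaD alphaZ] := ha; have alpha0 := frobenius_op0 ha.
apply: contrapT => none; case/eqP: nz.
rewrite (coord_expand dy) (big_morph alpha alphaD alpha0) [coords _]raddf_sum /= dual_sum.
apply: big1 => m /andP[bm _]; rewrite alphaZ linearZ /= -rmorphXn dual_const.
have [->|ym] := eqVneq (coords y m) 0.
  by rewrite expr0n -leqn0 leqNgt expn_gt0 p0 mul0r.
have [->|am] := eqVneq (coords (alpha (g (delta F m))) m') 0; first exact: mulr0.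
case: none; exists m; split=> // k; last exact: operator_support ha bm am k.
have := operator_support hb (balanced0) ym k; by rewrite mnm0E muln1.
Qed.

End OperatorCoefficients.

(** * Twisted Frobenius operators *)

Lemma sum_succ n (x : 'I_n -> nat) : (\sum_i (x i).+1 = \sum_i x i + n)%N.
Proof.
transitivity (\sum_i (x i + 1))%N; first by apply: eq_bigr => i _; rewrite addn1.
by rewrite big_split /= sum_nat_const card_ord muln1.
Qed.

Section TwistedFrobenius.
Variables (p : nat) (F : fieldType).
Hypothesis charF : p \in [pchar F].
Local Notation R := (detring F).
Local Notation mono := 'X_{1..2 + 3}.

Variables (e : nat) (w : 'I_(2 + 3) -> nat).
Local Notation q := (p ^ e)%N.

Definition twist_dvd (m : mono) : bool := [forall k, q %| m k + (w k).+1]%N.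
Definition twist_quo (m : mono) : mono := [multinom ((m k + (w k).+1) %/ q).-1 | k < 2 + 3].

(** The Frobenius of the functionals on the polynomial ring, followed by
    multiplication by the monomial of exponent w: the dual of x^m goes to the
    dual of x^(qm + q - 1 - w). *)
Definition twisted (f : dual F) : dual F :=
  fun m => if twist_dvd m then f (twist_quo m) ^+ q else 0.

Lemma q_gt0 : (0 < q)%N.
Proof. by rewrite expn_gt0 prime_gt0 // (pcharf_prime charF). Qed.

Lemma twist_quoE m k : twist_dvd m -> (m k + (w k).+1 = q * (twist_quo m k).+1)%N.
Proof.
move=> /forallP /(_ k) qm; rewrite mnmE prednK ?divn_gt0 ?q_gt0 //.
  by rewrite mulnC divnK.
by apply: dvdn_leq qm; rewrite addnS.
Qed.

Lemma frobenius_pow_add (A : comNzRingType) (x y : A) :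
  p \in [pchar A] -> (x + y) ^+ q = x ^+ q + y ^+ q.
Proof.
move=> charA; apply: exprDn_pchar; rewrite pnatX pnatE ?charA //.
exact: pcharf_prime charA.
Qed.

Lemma twistedD f f' : twisted (f + f') = twisted f + twisted f'.
Proof.
apply/funext => m; rewrite dualD /twisted; case: twist_dvd; last by rewrite addr0.
by rewrite dualD frobenius_pow_add.
Qed.

Lemma twistedZ (r : R) f : twisted (r *: f) = r ^+ q *: twisted f.
Proof.
elim/detring_ind: r f => [c|u|r s hr hs|r s hr hs] f.
- apply/funext => m; rewrite -rmorphXn dual_const /twisted; case: twist_dvd.
    by rewrite dual_const exprMn.
  by rewrite mulr0.
- apply/funext => m; rewrite dual_entryX /twisted dual_entry.
  have dvdE : twist_dvd (m + bidegree u *+ q)%MM = twist_dvd m.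
    apply: eq_forallb => k; rewrite mnmDE mulmnE addnAC dvdn_addl //.
    exact: dvdn_mull.
  rewrite dvdE; case: ifP => // /forallP qm; congr (f _ ^+ _); apply/mnmP => k.
  have -> : twist_quo (m + bidegree u *+ q)%MM k =
      ((bidegree u k * q + (m k + (w k).+1)) %/ q).-1.
    by rewrite mnmE mnmDE mulmnE -addnA addnCA.
  rewrite divnMDl ?q_gt0 // mnmDE mnmE.
  have : (0 < (m k + (w k).+1) %/ q)%N.
    by rewrite divn_gt0 ?q_gt0 //; apply: dvdn_leq (qm k); rewrite addnS.
  lia.
- have charR : p \in [pchar R] by apply: (rmorph_pchar (@const F)).
  by rewrite scalerDl twistedD hr hs frobenius_pow_add // scalerDl.
by rewrite -scalerA hr hs scalerA exprMn.
Qed.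

(* With these sums the operator takes balanced monomials to balanced ones. *)
Hypotheses (w_s : (\sum_(i < 2) w (lshift 3 i) = 0)%N)
  (w_t : ((\sum_(j < 3) w (rshift 2 j)).+1 = q)%N).

Lemma sdeg_twist m : twist_dvd m -> (sdeg m + 2 = q * (sdeg (twist_quo m) + 2))%N.
Proof.
move=> qm; have : (\sum_(i < 2) (m (lshift 3 i) + (w (lshift 3 i)).+1) =
                  \sum_(i < 2) q * (twist_quo m (lshift 3 i)).+1)%N.
  by apply: eq_bigr => i _; apply: twist_quoE.
rewrite -big_distrr big_split /= => h.
by move: h; rewrite !sum_succ w_s add0n.
Qed.

Lemma tdeg_twist m : twist_dvd m -> (tdeg m + 2 = q * (tdeg (twist_quo m) + 2))%N.
Proof.
move=> qm; have : (\sum_(i < 3) (m (rshift 2 i) + (w (rshift 2 i)).+1) =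
                  \sum_(i < 3) q * (twist_quo m (rshift 2 i)).+1)%N.
  by apply: eq_bigr => i _; apply: twist_quoE.
rewrite -big_distrr big_split /= => h.
move: h; rewrite !sum_succ -/(tdeg m) -/(tdeg (twist_quo m)) => h.
by apply: (@addIn q); rewrite -mulnSr -addnS -h -w_t -addnA add2n addn3.
Qed.

Lemma trunc_twisted d f : trunc d f -> trunc (q * (d + 2)) (twisted f).
Proof.
have q0 := q_gt0; move=> [fd fb]; split=> m hm; rewrite /twisted; case: ifP => // qm.
  rewrite fd ?expr0n ?gtn_eqF //.
  have := leq_trans hm (leq_addr 2 _); rewrite (sdeg_twist qm) leq_pmul2l //.
  by rewrite leq_add2r.
rewrite fb ?expr0n ?gtn_eqF //; apply: contra hm => /eqP hq; rewrite /balanced.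
by rewrite -(eqn_add2r 2) (sdeg_twist qm) (tdeg_twist qm) hq.
Qed.

Variables (E : lmodType R) (g : {linear dual F -> E}) (gC : is_cover g).

Lemma twisted_operator : frobenius_op p e (fun x => g (twisted (coords gC x))).
Proof.
split=> [x y|r x]; first by rewrite raddfD twistedD raddfD.
have -> : coords gC (r *: x) = r *: coords gC x by rewrite linearZ.
by rewrite twistedZ linearZ.
Qed.

(** The monomial m is x^(q - 1 - w), and the socle is spanned by the dual of 1. *)
Lemma twisted_delta0 (m : mono) : (forall k, (m k + (w k).+1 = q)%N) ->
  coords gC (g (twisted (coords gC (g (delta F 0%MM))))) m = 1.
Proof.
move=> mq; rewrite (coord_delta gC balanced0).
rewrite (coverK gC (trunc_twisted (trunc_delta F balanced0))) /twisted.
have -> : twist_dvd m by apply/forallP => k; rewrite mq.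
rewrite (_ : twist_quo m = 0%MM) ?/delta ?eqxx ?expr1n //.
by apply/mnmP => k; rewrite mnmE mq divnn q_gt0 mnm0E.
Qed.

End TwistedFrobenius.

(** * Indecomposable Frobenius operators *)

Section NotFinitelyGenerated.
Variables (p : nat) (F : fieldType).
Hypothesis charF : p \in [pchar F].
Local Notation R := (detring F).
Local Notation mono := 'X_{1..2 + 3}.

(** Here q = Q1 p T. The bounds on the b force their sum to be at least
    2 p T - 1, which exceeds the bound 2 p T - 2 on the sum of the a. *)
Lemma carry_contradiction Q1 T a0 a1 b0 b1 b2 : (1 < p)%N -> (1 < Q1)%N ->
  (a0 < p * T)%N -> (a1 < p * T)%N -> (a0 + a1 = b0 + b1 + b2)%N ->
  (Q1 * (p * T) - Q1 * T < Q1 * b0.+1)%N ->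
  (Q1 * (p * T) - p.-1 * (Q1 * T) < Q1 * b1.+1)%N ->
  (Q1 * (p * T) - 2 < Q1 * b2.+1)%N -> False.
Proof.
move=> p1 Q1gt a0T a1T ab hb0 hb1 hb2; have Q0 : (0 < Q1)%N by apply: ltnW.
have {}hb0 : (p * T - T <= b0)%N.
  by move: hb0; rewrite -mulnBr ltn_pmul2l.
have {}hb1 : (T <= b1)%N.
  move: hb1; rewrite (mulnCA p.-1) -mulnBr ltn_pmul2l // -mulnBl.
  by rewrite (_ : p - p.-1 = 1)%N ?mul1n //; lia.
have {}hb2 : (p * T < b2.+2)%N.
  rewrite -(ltn_pmul2l Q0); apply: leq_ltn_trans (_ : Q1 * (p * T) - 2 + 2 < _)%N.
    lia.
  apply: leq_trans (_ : Q1 * b2.+1 + 2 <= _)%N; first by rewrite ltn_add2r.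
  by rewrite [X in (_ <= X)%N]mulnS addnC leq_add2r.
have : (T <= p * T)%N by apply: leq_pmull; apply: ltnW.
lia.
Qed.

(** The weight w in degree e = n + 2, extended by zero to the exponents of s. *)
Definition spread (n : nat) (k : 'I_(2 + 3)) : nat :=
  if split k is inr j then
    nth 0 [:: (p ^ n.+1).-1; (p.-1 * p ^ n.+1).-1; 1] j
  else 0.

Lemma spread_l n i : spread n (lshift 3 i) = 0%N.
Proof. by rewrite /spread (unsplitK (inl i)). Qed.
Lemma spread_r n j : spread n (rshift 2 j) =
  nth 0 [:: (p ^ n.+1).-1; (p.-1 * p ^ n.+1).-1; 1] j.
Proof. by rewrite /spread (unsplitK (inr j)). Qed.

Lemma p_gt1 : (1 < p)%N.
Proof. exact: prime_gt1 (pcharf_prime charF). Qed.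

Lemma powers_gt0 n : [/\ (0 < p ^ n.+1)%N, (0 < p.-1 * p ^ n.+1)%N &
  (p ^ n.+2 = p ^ n.+1 + p.-1 * p ^ n.+1)%N].
Proof.
have p1 := p_gt1; have P0 : (0 < p ^ n.+1)%N by rewrite expn_gt0 ltnW.
split=> //; first by rewrite muln_gt0 P0 andbT -subn1 subn_gt0.
by rewrite -mulSn prednK ?(ltnW p1) // -expnS.
Qed.

Lemma spread_sum_l n : (\sum_(i < 2) spread n (lshift 3 i) = 0)%N.
Proof. by rewrite big1 // => i _; rewrite spread_l. Qed.

Lemma spread_sum_r n : ((\sum_(j < 3) spread n (rshift 2 j)).+1 = p ^ n.+2)%N.
Proof.
have [P0 P1 ->] := powers_gt0 n.
by rewrite !big_ord_recl big_ord0 !spread_r /=; lia.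
Qed.

Lemma spread_lt n k : (spread n k < p ^ n.+2)%N.
Proof.
rewrite -spread_sum_r ltnS; case: (split_ordP k) => j ->; first by rewrite spread_l.
by rewrite (bigD1 j) //= leq_addr.
Qed.

(** The exponent q - 1 - w. *)
Definition spread_dual n : mono := [multinom p ^ n.+2 - (spread n k).+1 | k < 2 + 3].

Lemma spread_dualE n k : (spread_dual n k + (spread n k).+1 = p ^ n.+2)%N.
Proof. by rewrite mnmE subnK // spread_lt. Qed.

Variables (E : lmodType R) (g : {linear dual F -> E}) (gC : is_cover g).
Local Notation coords := (coords gC).

(** The intermediate monomial has its two exponents in s below p^j, hence degree
    at most 2 p^j - 2, whereas its exponents in t are bounded below. *)
Lemma product_vanishes n i (alpha beta : E -> E) : (0 < i < n.+2)%N ->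
  frobenius_op p i alpha -> frobenius_op p (n.+2 - i) beta ->
  coords (alpha (beta (g (delta F 0%MM)))) (spread_dual n) = 0.
Proof.
move=> /andP[i0 ie] ha hb; have p1 := p_gt1; have p0 := ltnW p1.
apply/eqP; case: eqP => // /eqP nz; exfalso.
have [m [/eqP bm mj mi]] := product_support ha hb p0 nz.
have {}ie : (i <= n.+1)%N by [].
have jE : (n.+2 - i = (n.+1 - i).+1)%N by rewrite subSn.
have qE : (p ^ n.+2 = p ^ i * (p * p ^ (n.+1 - i)))%N.
  by rewrite -expnS -jE -expnD subnKC // ltnW.
have PE : (p ^ n.+1 = p ^ i * p ^ (n.+1 - i))%N by rewrite -expnD subnKC.
have [P0 P1 _] := powers_gt0 n.
have mjE k : (m k < p * p ^ (n.+1 - i))%N by rewrite -expnS -jE.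
have hi (j : 'I_3) : (p ^ n.+2 - (nth 0 [:: (p ^ n.+1).-1; (p.-1 * p ^ n.+1).-1; 1] j).+1
             < p ^ i * (m (rshift 2 j)).+1)%N.
  by have := mi (rshift 2 j); rewrite mnmE spread_r.
move: bm; rewrite /sdeg /tdeg !big_ord_recl !big_ord0 !addn0 addnA => bm.
apply: (@carry_contradiction (p ^ i) _ _ _ _ _ _ p1 _ (mjE _) (mjE _) bm).
- exact: leq_trans p1 (leq_pexp2l p0 i0).
- by rewrite -qE -PE; have := hi ord0; rewrite /= prednK.
- by rewrite -qE -PE; have := hi (lift ord0 ord0); rewrite /= prednK.
by rewrite -qE; apply: (hi (lift ord0 (lift ord0 ord0))).
Qed.

Lemma decomposable_vanishes n phi : decomposable p n.+2 phi ->
  coords (phi (g (delta F 0%MM))) (spread_dual n) = 0.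
Proof.
elim=> [|phi' i alpha beta _ IH ie ha hb]; first by rewrite raddf0.
by rewrite raddfD /= dualD IH (product_vanishes ie ha hb) addr0.
Qed.

(** The coefficient at q - 1 - w of the image of the socle is 1. *)
Lemma not_finitely_generated : ~ finitely_generated_over_degree0 p E.
Proof.
move=> /finitely_generated_decomposable [n gen].
have op := twisted_operator charF (n.+2) (spread n) gC.
have /decomposable_vanishes/eqP := gen _ _ (leqnSn n.+1) op.
rewrite (twisted_delta0 charF (spread_sum_l n) (spread_sum_r n) gC (spread_dualE n)).
by rewrite oner_eq0.
Qed.

End NotFinitelyGenerated.

Theorem mainTheorem3 (p : nat) (F : fieldType) (charF : p \in [pchar F])
    (E : lmodType (detring F)) (i : {linear quotmod (hommax F) -> E})
    (hullE : injective_hull i) :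
  (exists theta : {rmorphism completion (hommax F) -> frobring p E},
     [/\ injective theta,
         forall x, in_degree0 x <-> exists a, theta a = x &
         forall r m, fval (theta (to_completion (hommax F) r)) 0 m = r *: m])
  /\ ~ finitely_generated_over_degree0 p E.
Proof.
have [g gC] := hull_cover hullE; split; first exact: (matlis gC).
exact: (not_finitely_generated charF gC).
Qed.
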